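(* Let $K$ be an arbitrary field of characteristic $p>0$. Let $\mathcal C$ be the set of all subalgebras of $\mathcal D(P_n)$ of type $P_s\otimes\bigotimes_{i=1}^{n-s}\Lambda_{-1}^{[p^{k_i}]}$, $0\le s\le n$, $k_i\ge0$, and let $\mathcal C'=\{\Lambda_\varepsilon\mid\varepsilon\in\{\pm1\}^n\}$. Then the sets $\mathcal C$ and $\mathcal C'$ are holonomic sets of subalgebras with multiplicity $1$ for the ring of differential operators $\mathcal D(P_n)$ (equipped with the canonical filtration).
   Context: $\otimes=\otimes_K$; modules are left modules. $P_n=K[x_1,\dots,x_n]$, $n\ge1$; $\mathcal D(P_n)$ is the ring of $K$-linear differential operators on $P_n$. For $j\ge0$, $\partial_i^{[j]}=\frac{\partial_i^j}{j!}$ is the operator $x^\alpha\mapsto\binom{\alpha_i}{j}x^{\alpha-je_i}$ (zero if $j>\alpha_i$), $\partial^{[\beta]}=\prod_i\partial_i^{[\beta_i]}$. $\mathcal D(P_n)=\bigoplus_{\alpha,\beta}Kx^\alpha\partial^{[\beta]}\simeq\mathcal D(P_1)^{\otimes n}$; canonical filtration $F_i=\bigoplus_{|\alpha|+|\beta|\le i}Kx^\alpha\partial^{[\beta]}$. In $\mathcal D(P_1)=\mathcal D(K[x])$, $\Lambda_{-1}^{[p^k]}:=\bigoplus_{j\ge0}K\partial^{[jp^k]}$, a commutative subalgebra. A subalgebra of $\mathcal D(P_n)$ is of type $P_s\otimes\bigotimes_{i=1}^{n-s}\Lambda_{-1}^{[p^{k_i}]}$ if, after reordering the tensor factors of $\mathcal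 D(P_1)^{\otimes n}$, it equals $P_1^{\otimes s}\otimes\Lambda_{-1}^{[p^{k_1}]}\otimes\cdots\otimes\Lambda_{-1}^{[p^{k_{n-s}}]}$. For $\varepsilon\in\{\pm1\}^n$, $\Lambda_\varepsilon=\bigotimes_i\Lambda_{\varepsilon_i}$ with $i$-th factor $K[x_i]$ if $\varepsilon_i=1$ and $\bigoplus_{j\ge0}K\partial_i^{[j]}$ if $\varepsilon_i=-1$. For $f:\mathbb N\to\mathbb N$, $\gamma(f):=\inf\{r\ge0:f(i)\le i^r\text{ for }i\gg0\}$; for $M=\mathcal D(P_n)M_0$, $\dim_KM_0<\infty$, $\mathrm{Dim}(M):=\gamma(\dim_KF_iM_0)$. The holonomic number $h$ of $\mathcal D(P_n)$ is the infimum of $\mathrm{Dim}(M)$ over nonzero finitely generated $\mathcal D(P_n)$-modules $M$. A set $\{C_\nu\}_{\nu\in\mathcal N}$ of subalgebras of $\mathcal D(P_n)$ is a holonomic set of subalgebras with multiplicity $e>0$ if $h=n$ and for each nonzero $\mathcal D(P_n)$-module $M$ there exist a nonzero finite dimensional subspace $V\subseteq M$ and $\nu\in\mathcal N$ such that $\dim_K\bigl((C_\nu\cap F_i)V\bigr)\ge\frac e{n!}i^n+o(i^n)$. *)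

(* Defs.v *)
From HB Require Import structures.
From mathcomp Require Import all_boot all_order all_algebra.
From mathcomp Require Import perm zify.
From mathcomp Require Import boolp classical_sets functions.
From mathcomp Require Import reals ereal topology normedtype landau sequences exp.
(* The notations of mpoly.v and of topology.v cannot be loaded together. *)
From mathcomp Require Import -(notations) ssrcomplements mpoly.

Set Implicit Arguments.
Unset Strict Implicit.
Unset Printing Implicit Defensive.

Import Order.TTheory GRing.Theory Num.Theory.
Import numFieldNormedType.Exports.

Local Open Scope classical_set_scope.
Local Open Scope ring_scope.

Local Notation "{ 'mpoly' K [ n ] }" := (mpoly n K)
  (at level 0, K, n at level 2, format "{ 'mpoly'  K [ n ] }").

Section DifferentialOperators.
Variables (K : fieldType) (n : nat).
Local Notation P := {mpoly K[n]}.
Implicit Types (a b d : P -> P) (f g q : P) (k l : nat).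

Definition commop d f : P -> P := fun q => d (f * q) - f * d q.

(* Grothendieck's definition, shifted by one so as to start with the zero
   operator: [diffop_lt k d] means that [d] has order at most [k - 1]. *)
Fixpoint diffop_lt k d : Prop :=
  if k is k'.+1 then forall f, diffop_lt k' (commop d f) else d = 0.

Definition is_diffop d : Prop := linear d /\ exists k, diffop_lt k d.

Lemma linear_commop d f : linear d -> linear (commop d f).
Proof.
move=> dL c u v; rewrite /commop mulrDr -scalerAr !dL mulrDr -scalerAr.
by rewrite scalerBr opprD addrACA.
Qed.

Lemma diffop_lt0 k : diffop_lt k 0.
Proof.
elim: k => //= k IH f; rewrite (_ : commop 0 f = 0) //.
by apply/funext => q; rewrite /commop mulr0 subr0.
Qed.

Lemma diffop_ltD k a b : diffop_lt k a -> diffop_lt k b -> diffop_lt k (a + b).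
Proof.
elim: k a b => [a b -> ->|k IH a b Ha Hb f] /=; first by rewrite addr0.
rewrite (_ : commop _ f = commop a f + commop b f); first exact: IH.
by apply/funext => q; rewrite /commop !addrfctE mulrDr opprD addrACA.
Qed.

Lemma diffop_ltM k g d : diffop_lt k d -> diffop_lt k (fun q => g * d q).
Proof.
elim: k d => [d ->|k IH d Hd f] /=.
  by apply/funext => q; rewrite mulr0.
rewrite (_ : commop _ f = fun q => g * commop d f q); first exact: IH.
by apply/funext => q; rewrite /commop mulrBr mulrCA.
Qed.

Lemma diffop_ltZ k c d : diffop_lt k d -> diffop_lt k (c *: d).
Proof.
rewrite (_ : c *: d = fun q => c%:A * d q); first exact: diffop_ltM.
by apply/funext => q; rewrite -scalerAl mul1r.
Qed.

Lemma diffop_ltMr k g d : diffop_lt k d -> diffop_lt k (fun q => d (g * q)).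
Proof.
elim: k d => [d ->|k IH d Hd f] //=.
rewrite (_ : commop _ f = fun q => commop d f (g * q)); first exact: IH.
by apply/funext => q; rewrite /commop mulrCA.
Qed.

Lemma diffop_ltS k d : diffop_lt k d -> diffop_lt k.+1 d.
Proof.
elim: k d => [d -> f|k IH d Hd f]; last exact/IH/Hd.
exact: (diffop_lt0 1 f).
Qed.

Lemma diffop_ltW k l d : (k <= l)%N -> diffop_lt k d -> diffop_lt l d.
Proof.
by move=> /subnK <- ; elim: (l - k)%N => // i IH /IH; apply: diffop_ltS.
Qed.

Lemma linear_fun0 d : linear d -> d 0 = 0.
Proof.
by move=> dL; have := dL (-1) 0 0; rewrite scaleN1r oppr0 addr0 scaleN1r addNr.
Qed.

Lemma linear_funB d u v : linear d -> d (u - v) = d u - d v.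
Proof. by move=> dL; have := dL (-1) v u; rewrite !scaleN1r ![- _ + _]addrC. Qed.

Lemma diffop_lt_comp k l a b : linear a ->
  diffop_lt k a -> diffop_lt l b -> diffop_lt (k + l) (a \o b).
Proof.
elim: k l a b => [l a b _ -> _|k IHk l].
  by rewrite (_ : 0 \o b = 0) //; apply: diffop_lt0.
elim: l => [a b aL _ ->|l IHl a b aL Ha Hb].
  rewrite (_ : a \o 0 = 0); first exact: diffop_lt0.
  by apply/funext => q /=; apply: linear_fun0.
move=> f; change (diffop_lt (k + l.+1) (commop (a \o b) f)).
rewrite (_ : commop _ f = (a \o commop b f) + (commop a f \o b)).
  apply: diffop_ltD; last by apply: IHk => //; apply: linear_commop.
  by rewrite -addSnnS; apply: IHl => // g; apply: Hb.
by apply/funext => q; rewrite addrfctE /commop /= (linear_funB _ _ aL) addrA subrK.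
Qed.

Lemma is_diffop_mul f : is_diffop (fun q => f * q).
Proof.
split; first by move=> c u v; rewrite mulrDr scalerAr.
by exists 1%N => g /=; apply/funext => q; rewrite /commop mulrCA subrr.
Qed.

Lemma is_diffopB a b : is_diffop a -> is_diffop b -> is_diffop (a - b).
Proof.
move=> [aL [k Ha]] [bL [l Hb]]; split.
  move=> c u v; change (a (c *: u + v) - b (c *: u + v) =
    c *: (a u - b u) + (a v - b v)).
  by rewrite aL bL scalerBr opprD addrACA.
exists (maxn k l); apply: diffop_ltD.
  by apply: diffop_ltW Ha; apply: leq_maxl.
by rewrite -scaleN1r; apply/diffop_ltZ/(diffop_ltW _ Hb)/leq_maxr.
Qed.

Lemma is_diffopZ c a : is_diffop a -> is_diffop (c *: a).
Proof.
move=> [aL [k Ha]]; split; last by exists k; apply: diffop_ltZ.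
by move=> e u v; rewrite !scalrfctE aL scalerDr !scalerA mulrC.
Qed.

Lemma is_diffop_comp a b : is_diffop a -> is_diffop b -> is_diffop (a \o b).
Proof.
move=> [aL [k Ha]] [bL [l Hb]]; split; last first.
  by exists (k + l)%N; apply: diffop_lt_comp.
by move=> c u v /=; rewrite bL aL.
Qed.

Lemma is_diffop_id : is_diffop idfun.
Proof.
rewrite (_ : idfun = fun q => 1 * q); first exact: is_diffop_mul.
by apply/funext => q; rewrite mul1r.
Qed.

Lemma is_diffop0 : is_diffop 0.
Proof.
split; last by exists 0%N.
by move=> c u v; rewrite /= scaler0 addr0.
Qed.

End DifferentialOperators.

(* The ring D(P_n). *)
Record diffOp (K : fieldType) (n : nat) := DiffOp {
  diffop_fun :> {mpoly K[n]} -> {mpoly K[n]};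
  diffopP : `[< is_diffop diffop_fun >] }.
Arguments DiffOp {K n} _ _.

HB.instance Definition _ (K : fieldType) (n : nat) :=
  [isSub for @diffop_fun K n].
HB.instance Definition _ (K : fieldType) (n : nat) :=
  [Choice of diffOp K n by <:].

Section DiffOpAlgebra.
Variables (K : fieldType) (n : nat).
Local Notation P := {mpoly K[n]}.
Local Notation D := (diffOp K n).
Implicit Types (a b d : D).

Definition mkDiffOp (f : P -> P) (fP : is_diffop f) : D := DiffOp f (asboolT fP).

Lemma is_diffop_fun d : is_diffop d.
Proof. exact/asboolP/diffopP. Qed.

Lemma diffop_inj a b : (forall q, a q = b q) -> a = b.
Proof. by move=> ab; apply/val_inj/funext. Qed.

Lemma diffop_is_linear d : linear d.
Proof. by case: (is_diffop_fun d). Qed.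

Lemma is_diffop_opp d : is_diffop (- (d : P -> P)).
Proof. by rewrite -scaleN1r; apply/is_diffopZ/is_diffop_fun. Qed.

Lemma is_diffop_add a b : is_diffop ((a : P -> P) + (b : P -> P)).
Proof.
rewrite -[X in _ + X]opprK; apply: is_diffopB (is_diffop_fun a) _.
exact: is_diffop_opp.
Qed.

Definition diffop_zero : D := mkDiffOp (is_diffop0 K n).
Definition diffop_opp d : D := mkDiffOp (is_diffop_opp d).
Definition diffop_add a b : D := mkDiffOp (is_diffop_add a b).
Definition diffop_scale (c : K) d : D :=
  mkDiffOp (is_diffopZ c (is_diffop_fun d)).
Definition diffop_one : D := mkDiffOp (is_diffop_id K n).
Definition diffop_mul a b : D :=
  mkDiffOp (is_diffop_comp (is_diffop_fun a) (is_diffop_fun b)).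

Fact diffop_addA : associative diffop_add.
Proof. by move=> a b d; apply: diffop_inj => q /=; rewrite addrA. Qed.
Fact diffop_addC : commutative diffop_add.
Proof. by move=> a b; apply: diffop_inj => q /=; rewrite addrC. Qed.
Fact diffop_add0 : left_id diffop_zero diffop_add.
Proof. by move=> a; apply: diffop_inj => q /=; rewrite add0r. Qed.
Fact diffop_addN : left_inverse diffop_zero diffop_opp diffop_add.
Proof. by move=> a; apply: diffop_inj => q /=; rewrite addNr. Qed.

HB.instance Definition _ := GRing.isZmodule.Build D
  diffop_addA diffop_addC diffop_add0 diffop_addN.

Fact diffop_mulA : associative diffop_mul.
Proof. by move=> a b d; apply: diffop_inj. Qed.
Fact diffop_mul1 : left_id diffop_one diffop_mul.
Proof. by move=> a; apply: diffop_inj. Qed.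
Fact diffop_mulr1 : right_id diffop_one diffop_mul.
Proof. by move=> a; apply: diffop_inj. Qed.
Fact diffop_mulDl : left_distributive diffop_mul +%R.
Proof. by move=> a b d; apply: diffop_inj. Qed.
Fact diffop_mulDr : right_distributive diffop_mul +%R.
Proof.
move=> a b d; apply: diffop_inj => q /=.
by have := diffop_is_linear a 1 (b q) (d q); rewrite !scale1r.
Qed.
Fact diffop_oner_neq0 : diffop_one != 0.
Proof.
apply/eqP => /(congr1 (fun d : D => d 1)) /= /eqP.
by rewrite (negPf (oner_neq0 _)).
Qed.

HB.instance Definition _ := GRing.Zmodule_isNzRing.Build D
  diffop_mulA diffop_mul1 diffop_mulr1 diffop_mulDl diffop_mulDr
  diffop_oner_neq0.

Fact diffop_scaleA c e d :
  diffop_scale c (diffop_scale e d) = diffop_scale (c * e) d.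
Proof. by apply: diffop_inj => q /=; rewrite !scalrfctE scalerA. Qed.
Fact diffop_scale1 : left_id 1 diffop_scale.
Proof. by move=> d; apply: diffop_inj => q /=; rewrite scalrfctE scale1r. Qed.
Fact diffop_scaleDr : right_distributive diffop_scale +%R.
Proof. by move=> c a b; apply: diffop_inj => q /=; rewrite scalerDr. Qed.
Fact diffop_scaleDl d : {morph diffop_scale^~ d : c e / c + e}.
Proof. by move=> c e; apply: diffop_inj => q /=; rewrite scalerDl. Qed.

HB.instance Definition _ := GRing.Zmodule_isLmodule.Build K D
  diffop_scaleA diffop_scale1 diffop_scaleDr diffop_scaleDl.

Fact diffop_scaleAl (c : K) a b : c *: (a * b) = (c *: a) * b.
Proof. exact: diffop_inj. Qed.

HB.instance Definition _ := GRing.Lmodule_isLalgebra.Build K D diffop_scaleAl.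

Fact diffop_scaleAr (c : K) a b : c *: (a * b) = a * (c *: b).
Proof.
apply: diffop_inj => q; have := diffop_is_linear a c (b q) 0.
by rewrite (linear_fun0 (diffop_is_linear a)) !addr0.
Qed.

HB.instance Definition _ := GRing.Lalgebra_isAlgebra.Build K D diffop_scaleAr.

End DiffOpAlgebra.

Section DividedPowers.
Variables (K : fieldType) (n : nat).
Local Notation P := {mpoly K[n]}.
Implicit Types (f q : P) (m : multinom n).

Definition mulop f : diffOp K n := mkDiffOp (is_diffop_mul f).

Definition mlinext (F : multinom n -> P) q : P :=
  \sum_(m <- msupp q) mcoeff m q *: F m.

Lemma mlinextE F q k : (msize q <= k)%N ->
  mlinext F q = \sum_(m : bmultinom n k) mcoeff m q *: F m.
Proof.
move=> le_qk; rewrite /mlinext; set I : subFinType _ := bmultinom n k.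
rewrite (big_mksub I) ?msupp_uniq //=; last first.
  by move=> x /msize_mdeg_lt /leq_trans; apply.
by rewrite big_rmcond //= => j /memN_msupp_eq0 ->; rewrite scale0r.
Qed.

Lemma linear_mlinext F : linear (mlinext F).
Proof.
move=> c u v; pose k := maxn (msize (c *: u + v)) (maxn (msize u) (msize v)).
rewrite !(@mlinextE _ _ k) ?leq_max ?leqnn ?orbT //.
rewrite scaler_sumr -big_split /=; apply: eq_bigr => m _.
by rewrite mcoeffD mcoeffZ scalerDl scalerA.
Qed.

Lemma mlinextX F m : mlinext F (mpolyX K m) = F m.
Proof. by rewrite /mlinext msuppX big_seq1 mcoeffX eqxx scale1r. Qed.

(* When [beta] is not below [m], some binomial vanishes, so that the truncated
   subtraction of exponents is harmless. *)
Definition divpow (beta : multinom n) : P -> P :=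
  mlinext (fun m => (\prod_(i < n) 'C(m i, beta i))%N%:R *: mpolyX K (mnm_sub m beta)).

Lemma divpowX beta m : divpow beta (mpolyX K m) =
  (\prod_(i < n) 'C(m i, beta i))%N%:R *: mpolyX K (mnm_sub m beta).
Proof. exact: mlinextX. Qed.

Lemma linear_eq_X (a b : P -> P) : linear a -> linear b ->
  (forall m, a (mpolyX K m) = b (mpolyX K m)) -> a = b.
Proof.
move=> aL bL ab; apply/funext; elim/mpolyind => [|c m p _ _ IH].
  by rewrite !linear_fun0.
by rewrite aL bL ab IH.
Qed.

Lemma commop_divpow i beta : commop (divpow beta) (mpolyX K (mnm1 i)) =
  if beta i == 0%N then 0 else divpow (mnm_sub beta (mnm1 i)).
Proof.
apply: linear_eq_X; first by apply/linear_commop/linear_mlinext.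
  by case: ifP => _; [case: (is_diffop0 K n)|apply: linear_mlinext].
move=> m; rewrite /commop -mpolyXD !divpowX -scalerAr -mpolyXD.
have E1 : (\prod_(j < n) 'C(mnm_add (mnm1 i) m j, beta j) =
    'C((m i).+1, beta i) * \prod_(j | j != i) 'C(m j, beta j))%N.
  rewrite (bigD1 i) //= mnmDE mnm1E eqxx add1n; congr (_ * _)%N.
  by apply: eq_bigr => j ji; rewrite mnmDE mnm1E eq_sym (negPf ji).
have E2 : (\prod_(j < n) 'C(m j, beta j) =
    'C(m i, beta i) * \prod_(j | j != i) 'C(m j, beta j))%N.
  by rewrite (bigD1 i).
rewrite E1 E2; case: ifP => [/eqP b0|/negbT b0].
  rewrite b0 !bin0 !mul1n.
  rewrite (_ : mnm_sub (mnm_add (mnm1 i) m) beta =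
    mnm_add (mnm1 i) (mnm_sub m beta)).
    by rewrite subrr.
  apply/mnmP => j; rewrite !(mnmDE, mnmBE, mnm1E).
  by case: eqVneq => [<-|_]; rewrite ?b0 ?subn0.
have E3 : (\prod_(j < n) 'C(m j, mnm_sub beta (mnm1 i) j) =
    'C(m i, (beta i).-1) * \prod_(j | j != i) 'C(m j, beta j))%N.
  rewrite (bigD1 i) //= mnmBE mnm1E eqxx subn1; congr (_ * _)%N.
  by apply: eq_bigr => j ji; rewrite mnmBE mnm1E eq_sym (negPf ji) subn0.
rewrite divpowX E3.
rewrite (_ : mnm_sub m (mnm_sub beta (mnm1 i)) =
             mnm_sub (mnm_add (mnm1 i) m) beta); last first.
  apply/mnmP => j; rewrite !(mnmDE, mnmBE, mnm1E).
  by case: eqVneq => [<-|_]; [move: b0; lia|rewrite subn0 add0n].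
have [lt_mb|le_bm] := ltnP (m i) (beta i).
  rewrite [in X in _ - X]bin_small // mul0n scale0r subr0.
  by rewrite -(prednK (n := beta i)) ?lt0n // binS bin_small ?add0n ?prednK ?lt0n.
rewrite (_ : mnm_add (mnm1 i) (mnm_sub m beta) =
             mnm_sub (mnm_add (mnm1 i) m) beta); last first.
  apply/mnmP => j; rewrite !(mnmDE, mnmBE, mnm1E).
  by case: eqVneq => [<-|_]; [move: b0 le_bm; lia|].
rewrite -scalerBl -{1}(prednK (n := beta i)) ?lt0n // binS prednK ?lt0n //.
by rewrite mulnDl natrD addrAC subrr add0r.
Qed.

Lemma diffop_lt_gen k (d : P -> P) : linear d ->
  (forall i, diffop_lt k (commop d (mpolyX K (mnm1 i)))) -> diffop_lt k.+1 d.
Proof.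
move=> dL dX.
have d1 : diffop_lt k (commop d 1).
  rewrite (_ : commop d 1 = 0); first exact: diffop_lt0.
  by apply/funext => q; rewrite /commop !mul1r subrr.
have dM f g : diffop_lt k (commop d f) -> diffop_lt k (commop d g) ->
    diffop_lt k (commop d (f * g)).
  move=> Hf Hg; rewrite (_ : commop d _ = (fun q => commop d f (g * q)) +
     (fun q => f * commop d g q)).
    by apply: diffop_ltD; [apply: diffop_ltMr|apply: diffop_ltM].
  apply/funext => q; rewrite addrfctE /commop.
  by rewrite mulrBr !mulrA addrA subrK.
elim/mpolyind => [|c m p _ _ IH].
  rewrite (_ : commop d 0 = 0); first exact: diffop_lt0.
  by apply/funext => q; rewrite /commop !mul0r linear_fun0 // subrr.
rewrite (_ : commop d _ = c *: commop d (mpolyX K m) + commop d p); last first.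
  apply/funext => q; rewrite addrfctE scalrfctE /commop mulrDl -scalerAl dL.
  by rewrite mulrDl -scalerAl scalerBr opprD addrACA.
apply: diffop_ltD IH; apply: diffop_ltZ.
rewrite mpolyXE_id; apply: (big_ind (fun f => diffop_lt k (commop d f))) => //.
by move=> i _; elim: (m i) => [|j IHj]; rewrite ?expr0 // exprS; apply: dM.
Qed.

Lemma diffop_lt_divpow k beta : (mdeg beta < k)%N -> diffop_lt k (divpow beta).
Proof.
elim: k beta => // k IH beta lt_bk.
apply: diffop_lt_gen => [|i]; first exact: linear_mlinext.
rewrite commop_divpow; case: ifPn => [_|b0]; first exact: diffop_lt0.
apply: IH; rewrite -ltnS; apply: leq_trans lt_bk.
have le_ib : lem (mnm1 i) beta by rewrite lep1mP.
by rewrite -[in leqRHS](submK le_ib) mdegD mdeg1 addn1.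
Qed.

Lemma is_diffop_divpow beta : is_diffop (divpow beta).
Proof.
split; first exact: linear_mlinext.
by exists (mdeg beta).+1; apply: diffop_lt_divpow.
Qed.

Definition divop beta : diffOp K n := mkDiffOp (is_diffop_divpow beta).

End DividedPowers.

Section Spans.
Variables (K : fieldType) (V : lmodType K).
Implicit Types (S W : set V).

Definition lin_span S : set V := [set v | exists (r : nat) (c : 'I_r -> K)
  (w : 'I_r -> V), (forall i, S (w i)) /\ v = \sum_i c i *: w i].

Definition lin_indep (r : nat) (b : 'I_r -> V) : Prop :=
  forall c : 'I_r -> K, \sum_i c i *: b i = 0 -> forall i, c i = 0.

Definition has_dim W (r : nat) : Prop :=
  exists b : 'I_r -> V, lin_indep b /\ W = lin_span (range b).

Definition fin_dim W : Prop := exists r, has_dim W r.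

(* The dimension of a finite dimensional subspace (junk value 0 otherwise). *)
Definition dimK W : nat := xget 0%N [set r | has_dim W r].

End Spans.

(* The K-vector space underlying a D(P_n)-module. *)
Definition resK (K : fieldType) (n : nat) (M : lmodType (diffOp K n)) : Type := M.

Section RestrictionOfScalars.
Variables (K : fieldType) (n : nat) (M : lmodType (diffOp K n)).

HB.instance Definition _ := GRing.Zmodule.on (resK M).

Definition resK_scale (c : K) (v : resK M) : resK M :=
  (c%:A : diffOp K n) *: (v : M).

Fact resK_scaleA c e v : resK_scale c (resK_scale e v) = resK_scale (c * e) v.
Proof. by rewrite /resK_scale scalerA -scalerAl mul1r scalerA. Qed.
Fact resK_scale1 : left_id 1 resK_scale.
Proof. by move=> v; rewrite /resK_scale !scale1r. Qed.
Fact resK_scaleDr : right_distributive resK_scale +%R.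
Proof. by move=> c u v; rewrite /resK_scale scalerDr. Qed.
Fact resK_scaleDl v : {morph resK_scale^~ v : c e / c + e}.
Proof. by move=> c e; rewrite /resK_scale !scalerDl. Qed.

HB.instance Definition _ := GRing.Zmodule_isLmodule.Build K (resK M)
  resK_scaleA resK_scale1 resK_scaleDr resK_scaleDl.

(* The product A W is the span of the elementary products a w. *)
Definition act_span (A : set (diffOp K n)) (W : set (resK M)) : set (resK M) :=
  lin_span [set ((a *: (w : M) : M) : resK M) | a in A & w in W].

End RestrictionOfScalars.

Section CanonicalFiltration.
Variables (K : fieldType) (n : nat).

Definition canF (i : nat) : set (diffOp K n) :=
  lin_span [set d | exists alpha beta : multinom n,
    (mdeg alpha + mdeg beta <= i)%N /\
    d = mulop (mpolyX K alpha) * divop K beta].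

End CanonicalFiltration.

Section HolonomicSets.
Variables (R : realType) (K : fieldType) (n : nat).

Definition growth (f : nat -> nat) : \bar R :=
  ereal_inf [set r%:E | r in [set r : R |
    0 <= r /\ \forall i \near \oo, (f i)%:R <= (i%:R : R) `^ r]].

(* [is_Dim M d] : M = D(P_n) M_0 with M_0 finite dimensional, and d is the
   growth of dim F_i M_0 (this does not depend on M_0). *)
Definition is_Dim (M : lmodType (diffOp K n)) (d : \bar R) : Prop :=
  exists M0 : set (resK M), [/\ fin_dim M0, act_span setT M0 = setT &
    d = growth (fun i => dimK (act_span (@canF K n i) M0))].

Definition holonomic_number : \bar R :=
  ereal_inf [set d | exists M : lmodType (diffOp K n),
    (exists v : M, v != 0) /\ is_Dim M d].

Definition holonomic_set (Cs : set (set (diffOp K n))) (e : R) : Prop :=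
  [/\ 0 < e,
      forall C, Cs C -> GRing.subalg_closed (mem C),
      holonomic_number = n%:R%:E &
      forall M : lmodType (diffOp K n), (exists v : M, v != 0) ->
        exists (V : set (resK M)) (C : set (diffOp K n)),
          [/\ fin_dim V, exists2 v, V v & v != 0, Cs C &
           exists g : nat -> R^o, g =o_\oo (fun i => i%:R ^+ n : R^o) /\
             forall i, e / n`!%:R * i%:R ^+ n + g i <=
               (dimK (act_span (C `&` @canF K n i) V))%:R]].

End HolonomicSets.

Section TensorSubalgebras.
Variables (K : fieldType) (n : nat).

Definition subst1 (i : 'I_n) : {mpoly K[1]} -> {mpoly K[n]} :=
  comp_mpoly [tuple mpolyX K (mnm1 i)].

(* [d] is the image of the pure tensor of the [a i] under the isomorphism of
   the n-th tensor power of D(P_1) with D(P_n). *)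
Definition is_pure_tensor (a : 'I_n -> diffOp K 1) (d : diffOp K n) : Prop :=
  forall m : multinom n,
    d (mpolyX K m) = \prod_i subst1 i (a i (mpolyX K (mnm1 ord0) ^+ m i)).

Definition tensor (B : 'I_n -> set (diffOp K 1)) : set (diffOp K n) :=
  lin_span [set d | exists a, (forall i, B i (a i)) /\ is_pure_tensor a d].

End TensorSubalgebras.

Section Families.
Variables (K : fieldType).

(* K[x] inside D(K[x]), acting by multiplication. *)
Definition polyD1 : set (diffOp K 1) := range (@mulop K 1).

Definition LambdaD1 (q : nat) : set (diffOp K 1) :=
  lin_span (range (fun j : nat => divop K (mnm_muln (mnm1 (@ord0 0)) (j * q)))).

Definition calC (p n : nat) : set (set (diffOp K n)) :=
  [set C | exists (s : nat) (k : nat -> nat) (t : 'S_n), (s <= n)%N /\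
    C = tensor (fun i : 'I_n =>
      if (t i < s)%N then polyD1 else LambdaD1 (p ^ k (t i - s)%N))].

Definition calC' (n : nat) : set (set (diffOp K n)) :=
  [set C | exists eps : 'I_n -> int, (forall i, eps i = 1 \/ eps i = -1) /\
    C = tensor (fun i => if eps i == 1 then polyD1 else LambdaD1 1)].

End Families.

Arguments calC K p n : clear implicits.
Arguments calC' K n : clear implicits.

(* Main.v *)
Require Import Defs.
From HB Require Import structures.
From mathcomp Require Import all_boot all_order all_algebra.
From mathcomp Require Import perm zify ring.
From mathcomp Require Import boolp classical_sets functions.
From mathcomp Require Import reals ereal normedtype landau exp.
From mathcomp Require Import -(notations) mpoly.

(** The heart is a nonzero vector v, in any nonzero module, on which some
    Lambda_epsilon acts freely; it is found one variable at a time, over a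
    growing polynomial ring A acting without torsion on a nonzero subgroup N of
    M. If A[x_i] still acts without torsion, take epsilon_i = 1 and replace A by
    A[x_i]. Otherwise pick F != 0 of least degree such that F(x_i) kills a
    nonzero vector, and let q be the largest power of p such that F is a
    polynomial in x_i^q. The q-th Hasse derivative of F is nonzero of smaller
    degree, hence injective on N, and commuting F past the d_i^[qb] shows that
    they act independently on ker F. The d_i^[a], 0 < a < q, commute with F and
    have a nonzero common kernel in ker F; continue inside this kernel, and
    finally multiply the vector found there by x_i^(q-1), on which d_i^[a] acts
    as +- x_i^(q-1-a). This takes epsilon_i = -1 and keeps A.

    Counting monomials gives dim ((Lambda_epsilon \cap F_i) v) >= binom(n+i, n)
    >= i^n / n!. Since D(P_n) is the union of the F_i, a finite dimensional
    generating space M_0 satisfies F_(i+l) M_0 >= (Lambda_epsilon \cap F_i) v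
    for some l, so that Dim M >= n, with equality for M = P_n. *)

Set Implicit Arguments.
Unset Strict Implicit.
Unset Printing Implicit Defensive.

Import Order.TTheory GRing.Theory Num.Theory.
Import numFieldNormedType.Exports.

Local Open Scope classical_set_scope.
Local Open Scope ring_scope.

(** * Binomial coefficients modulo p *)

Section BinomialsModP.
Variables (R : nzRingType) (p k : nat).
Hypothesis charR : p \in [pchar R].
Local Notation q := (p ^ k)%N.

Let q_gt0 : (0 < q)%N.
Proof. by rewrite expn_gt0 prime_gt0 ?(pcharf_prime charR). Qed.

(** Reduces identities between natural numbers in [R], which need not be commutative, to polynomial
    arithmetic over F_p. *)
Let natr_eq_Fp (m1 m2 : nat) : m1%:R = m2%:R :> 'F_p -> m1%:R = m2%:R :> R.
Proof.
have p_pr := pcharf_prime charR => /(congr1 (@nat_of_ord _)).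
rewrite !val_Fp_nat // => E.
by rewrite -(GRing.natr_mod_pchar charR) E GRing.natr_mod_pchar.
Qed.

(** Compares coefficients in (1 + X)^(q + m) = (1 + X^q) (1 + X)^m over F_p. *)
Lemma bin_addq (m c : nat) : 'C(q + m, c)%:R =
  'C(m, c)%:R + (if (c < q)%N then 0 else 'C(m, c - q)%:R) :> R.
Proof.
rewrite -(fun_if (fun i => i%:R) _ 0%N) -natrD; apply: natr_eq_Fp.
have charFp : p \in [pchar {poly 'F_p}].
  by rewrite pchar_poly pchar_Fp ?(pcharf_prime charR).
have coefB m' i : ((1 + 'X) ^+ m')`_i = 'C(m', i)%:R :> 'F_p.
  rewrite exprDn.
  under eq_bigr => j _ do rewrite expr1n mul1r -scaler_nat.
  rewrite -(poly_def _ (fun j => 'C(m', j)%:R)) coef_poly.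
  by case: ltnP => // ?; rewrite bin_small.
rewrite -coefB exprD exprDn_pchar; last first.
  by rewrite (eq_pnat _ (pcharf_eq charFp)) pnatX pnat_id ?(pcharf_prime charR).
rewrite expr1n mulrDl mul1r coefD coefXnM coefB natrD; congr (_ + _).
by case: ifP => // _; rewrite coefB.
Qed.

(** Induction on [b]: adding q to the upper entry acts, through [bin_addq], as Pascal's rule on the
    high parts [b] and [d]. *)
Lemma bin_lucas (a b c d : nat) : (a < q)%N -> (c < q)%N ->
  'C(a + q * b, c + q * d)%:R = ('C(a, c) * 'C(b, d))%:R :> R.
Proof.
move=> aq cq; elim: b d => [|b IH] [|d].
- by rewrite !muln0 !addn0 bin0 muln1.
- by rewrite muln0 addn0 bin0n muln0 bin_small //; nia.
- rewrite mulnS addnCA bin_addq ifT; last by rewrite muln0 addn0.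
  by rewrite addr0 IH !bin0.
rewrite mulnS addnCA bin_addq IH ifF; last by apply/negbTE; rewrite -leqNgt; nia.
by rewrite (_ : (_ - q = c + q * d)%N) ?IH ?binS ?mulnDr ?natrD //; nia.
Qed.

(** Writing i + j = q + m gives m < i, so both terms of [bin_addq] vanish. *)
Lemma bin_carry (i j : nat) :
  (i < q)%N -> (j < q)%N -> (q <= i + j)%N -> 'C(i + j, i)%:R = 0 :> R.
Proof.
move=> iq jq qij; rewrite -(subnKC qij) bin_addq iq addr0 bin_small //; lia.
Qed.

(** Row q of Pascal's triangle vanishes modulo p strictly between its ends, so neighbouring entries
    of row q - 1 are opposite. *)
Lemma bin_pred (a : nat) : (a < q)%N -> 'C(q.-1, a)%:R = (-1) ^+ a :> R.
Proof.
elim: a => [|a IH] aq; first by rewrite bin0 expr0.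
have := bin_addq 0 a.+1; rewrite aq addn0 bin0n addr0 -{1}(prednK q_gt0) binS natrD.
by rewrite IH 1?ltnW // exprS mulN1r => /eqP; rewrite addr_eq0 => /eqP.
Qed.

End BinomialsModP.

(** * Hasse derivatives in characteristic p *)

Section HasseDerivatives.
Variables (A : idomainType) (p : nat).
Hypothesis charA : p \in [pchar A].

(** Take for [k] the least p-adic valuation of a positive exponent of F, so that F is a polynomial
    in X^q, q = p^k. If the exponent i attains it, Lucas gives 'C(i, q) = i/q modulo p, which is
    nonzero. If q divides l + j but not l, Lucas makes 'C(l + j, l) vanish. *)
Lemma nderivn_pchar (F : {poly A}) : (1 < size F)%N ->
  exists2 k, F^`N(p ^ k) != 0 & forall l, ~~ (p ^ k %| l)%N -> F^`N(l) = 0.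
Proof.
move=> F_gt1; have p_pr := pcharf_prime charA.
have F0 : F`_(size F).-1 != 0 by rewrite lead_coef_eq0 -size_poly_gt0 ltnW.
have i0_lt : ((size F).-1 < size F)%N by rewrite prednK // ltnW.
pose P (i : 'I_(size F)) := (0 < i)%N && (F`_i != 0).
have P0 : P (Ordinal i0_lt) by rewrite /P /= F0 andbT -subn1 subn_gt0.
case: (arg_minnP (fun i : 'I_(size F) => logn p i) P0) => i /andP[i_gt0 Fi] imin.
have q_gt0 : (0 < p ^ logn p i)%N by rewrite expn_gt0 prime_gt0.
exists (logn p i) => [|l ndiv].
  have le_qi : (p ^ logn p i <= i)%N by apply/dvdn_leq/pfactor_dvdnn.
  apply/eqP => /(congr1 (fun G : {poly A} => G`_(i - p ^ logn p i))).
  rewrite coef_nderivn coef0 subnKC // -mulr_natl.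
  have [b pb Eb] := pfactor_coprime p_pr i_gt0.
  have := @bin_lucas A p (logn p i) charA 0 b 0 1 q_gt0 q_gt0.
  rewrite !add0n muln1 bin0 mul1n bin1 mulnC -Eb => -> /eqP.
  rewrite mulf_eq0 (negPf Fi) orbF -(dvdn_pcharf charA).
  by apply/negP; rewrite -prime_coprime.
apply/polyP => j; rewrite coef_nderivn coef0.
have [->|Flj] := eqVneq F`_(l + j) 0; first by rewrite mul0rn.
have lj_gt0 : (0 < l + j)%N by case: l ndiv {Flj} => //; rewrite dvdn0.
have lj_lt : (l + j < size F)%N.
  by rewrite ltnNge; apply: contra Flj => ?; rewrite nth_default.
have := imin (Ordinal lj_lt); rewrite /P /= lj_gt0 Flj => /(_ isT) le_log.
have /dvdnP[b Eb] : (p ^ logn p i %| l + j)%N by rewrite pfactor_dvdn.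
have := @bin_lucas A p (logn p i) charA 0 b (l %% p ^ logn p i)
  (l %/ p ^ logn p i) q_gt0 (ltn_pmod l q_gt0).
have El : (l %% p ^ logn p i + p ^ logn p i * (l %/ p ^ logn p i) = l)%N.
  by rewrite addnC mulnC -divn_eq.
rewrite El add0n [(_ * b)%N]mulnC -Eb bin0n.
rewrite (_ : (_ == 0)%N = false) ?mul0n => [E|]; last exact/negbTE.
by rewrite -mulr_natl E mul0r.
Qed.

End HasseDerivatives.

(** * Free vectors *)

Section DividedPowerVariable.
Variables (D : nzRingType) (A : idomainType) (rho : {rmorphism A -> D}).
Variables (x : D) (d : nat -> D).
Hypothesis d0 : d 0%N = 1.
Hypothesis dM : forall a b, d a * d b = d (a + b)%N *+ 'C(a + b, a).
Hypothesis xd : forall j, x * d j.+1 = d j.+1 * x - d j.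
Hypothesis x_rho : commr_rmorph rho x.
Hypothesis d_rho : forall j a, GRing.comm (d j) (rho a).

Local Notation ev := (horner_morph x_rho).

Lemma ev_comm F G : GRing.comm (ev F) (ev G).
Proof. by rewrite /GRing.comm -!rmorphM mulrC. Qed.

(** Horner induction on F: moving one [x] past [d j.+1] costs a term - [d j], whence the signs, and
    these terms collect into the Hasse derivatives. *)
Lemma ev_divpow (F : {poly A}) (j : nat) :
  ev F * d j = \sum_(l < j.+1) d (j - l)%N * ev ((-1) ^+ l *: F^`N(l)).
Proof.
elim/poly_ind: F j => [|F c IH] j.
  by rewrite rmorph0 mul0r big1 // => l _; rewrite linear0 scaler0 rmorph0 mulr0.
rewrite rmorphD rmorphM /= horner_morphX horner_morphC mulrDl.
case: j => [|j].
  rewrite d0 !mulr1 big_ord1 mul1r expr0 scale1r nderivn0.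
  by rewrite rmorphD rmorphM /= horner_morphX horner_morphC.
rewrite -mulrA xd mulrBr mulrA !IH big_ord_recl [RHS]big_ord_recl /=.
rewrite !subn0 expr0 !scale1r !nderivn0 rmorphD rmorphM /= horner_morphX.
rewrite horner_morphC mulrDr mulrDl -!mulrA -!addrA; congr (_ + _).
rewrite -(d_rho _ c) [in RHS]addrC addrA; congr (_ + _).
rewrite mulr_suml -sumrB; apply: eq_bigr => l _.
rewrite /bump leq0n add1n subSS nderivnMXaddC scalerDr rmorphD /=.
rewrite mulrDr addrC; congr (_ + _).
  by rewrite exprS mulN1r scaleNr rmorphN mulrN.
by rewrite scalerAl rmorphM /= horner_morphX mulrA.
Qed.

(** * One variable, when a polynomial in it kills a nonzero vector *)

Section Torsion.
Variables (M : lmodType D) (p k : nat) (F : {poly A}) (N : M -> Prop).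
Hypothesis charA : p \in [pchar A].
Hypothesis F_div : forall l, ~~ (p ^ k %| l)%N -> F^`N(l) = 0.
Hypothesis N_0 : N 0.
Hypothesis N_add : forall u v, N u -> N v -> N (u + v).
Hypothesis N_rho : forall a u, N u -> N (rho a *: u).
Hypothesis N_x : forall u, N u -> N (x *: u).
Hypothesis N_d : forall j u, N u -> N (d j *: u).
Hypothesis F_inj : forall u, N u -> ev F^`N(p ^ k) *: u = 0 -> u = 0.
Local Notation q := (p ^ k)%N.

Let charD : p \in [pchar D]. Proof. exact: rmorph_pchar charA. Qed.
Let q_gt0 : (0 < q)%N.
Proof. by rewrite expn_gt0 prime_gt0 ?(pcharf_prime charA). Qed.

Definition polyker (u : M) := N u /\ ev F *: u = 0.

(** On such vectors w, the [d j] with j < q differentiate x^m w as if w were a constant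
    ([divpow_xn]). *)
Definition polykerd (u : M) :=
  polyker u /\ forall a, (0 < a < q)%N -> d a *: u = 0.

Lemma closed_sum r (P : pred 'I_r) (u : 'I_r -> M) :
  (forall i, P i -> N (u i)) -> N (\sum_(i | P i) u i).
Proof. by move=> Nu; apply: (big_ind N). Qed.

Lemma closed_horner G u : N u -> N (ev G *: u).
Proof.
move=> Nu; elim/poly_ind: G => [|G c NG]; first by rewrite rmorph0 scale0r.
rewrite rmorphD rmorphM /= horner_morphX horner_morphC scalerDl.
have := ev_comm G 'X; rewrite /GRing.comm /= horner_morphX => ->.
by apply: N_add; [rewrite -scalerA; apply: N_x|apply: N_rho].
Qed.

Lemma polyker_ev G u : polyker u -> polyker (ev G *: u).
Proof.
case=> Nu Fu; split; first exact: closed_horner.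
by rewrite scalerA ev_comm -scalerA Fu scaler0.
Qed.

Lemma polyker_sum r (P : pred 'I_r) (u : 'I_r -> M) :
  (forall i, P i -> polyker (u i)) -> polyker (\sum_(i | P i) u i).
Proof.
move=> Zu; split; first by apply: closed_sum => i /Zu[].
by rewrite scaler_sumr big1 // => i /Zu[].
Qed.

(** The correction terms of [ev_divpow] involve derivatives of order l with 0 < l < q, which are
    zero by [F_div]; so [d a] commutes with F(x). *)
Lemma polyker_divpow a u : (a < q)%N -> polyker u -> polyker (d a *: u).
Proof.
move=> aq [Nu Fu]; split; first exact: N_d.
rewrite scalerA ev_divpow scaler_suml big1 // => -[[|l] lt_la] _ /=.
  by rewrite expr0 scale1r nderivn0 -scalerA Fu scaler0.
rewrite F_div ?scaler0 ?rmorph0 ?mulr0 ?scale0r //.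
by apply/negP => /dvdn_leq; lia.
Qed.

(* The last nonzero [d a *: u] with [a < q] works, because ['C(b + a, b)] vanishes
   modulo [p] when [a, b < q <= b + a]. *)
Lemma polykerd_neq0 u : polyker u -> u != 0 -> exists2 w, polykerd w & w != 0.
Proof.
move=> Zu u0; pose P (a : 'I_q) := d a *: u != 0.
have P0 : P (Ordinal q_gt0) by rewrite /P d0 scale1r.
case: (arg_maxnP (fun a : 'I_q => nat_of_ord a) P0) => a Pa amax.
exists (d a *: u) => //; split; first exact: polyker_divpow.
move=> b /andP[b_gt0 bq]; rewrite scalerA dM -mulr_natl.
have [q_le|lt_q] := leqP q (b + a).
  by rewrite (@bin_carry D p k) // mul0r scale0r.
have [E|nz] := eqVneq (d (b + a)%N *: u) 0; first by rewrite -scalerA E scaler0.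
by have := amax (Ordinal lt_q) nz; rewrite /= /geq /=; lia.
Qed.

(** Among the terms of [ev_divpow], [F_div] leaves only those whose order is a multiple of q. *)
Lemma ev_divpowq (i : nat) : ev F * d (q * i)%N =
  \sum_(l < i.+1) d (q * (i - l))%N * ev ((-1) ^+ (q * l)%N *: F^`N(q * l)).
Proof.
pose G l := d (q * i - l)%N * ev ((-1) ^+ l *: F^`N(l)).
rewrite ev_divpow; under [RHS]eq_bigr => l _ do rewrite mulnBr.
rewrite -(big_mkord xpredT G) -(big_mkord xpredT (fun l => G (q * l)%N)).
(* The induction is on the number of blocks of length q; the [i] inside [G] stays fixed. *)
elim: {1 2}i => [|b IH]; first by rewrite !muln0 !big_nat1 muln0.
rewrite [RHS]big_nat_recr //= -IH (@big_cat_nat _ _ _ (q * b).+1) //=; last by nia.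
congr (_ + _); rewrite big_nat_recr /=; last by nia.
rewrite big_nat big1 ?add0r // => l /andP[l1 l2].
rewrite /G F_div ?scaler0 ?rmorph0 ?mulr0 //.
apply/negP => /dvdnP[e El]; move: l1 l2.
by rewrite El [(e * _)%N]mulnC !ltn_pmul2l //; lia.
Qed.

(* Applying [ev F] to the relation lowers its length by one and turns the top
   vector [u b] into [+- F^`N(q)] applied to it. *)
Lemma divpowq_top (b : nat) (u : nat -> M) : (forall i, polyker (u i)) ->
  \sum_(i < b.+1) d (q * i)%N *: u i = 0 -> u b = 0.
Proof.
elim: b u => [|b IH] u Zu; first by rewrite big_ord1 muln0 d0 scale1r.
(* [u' e] is the coefficient of [d (q * e)] once F(x) has been moved to the right; the terms i = e
   drop out because F(x) kills [u i]. *)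
move=> E; pose H l : {poly A} := (-1) ^+ (q * l)%N *: F^`N(q * l).
pose u' e := \sum_(i < b.+2 | (e < i)%N) ev (H (i - e)%N) *: u i.
have Zu' e : polyker (u' e) by apply: polyker_sum => i _; apply: polyker_ev.
have : u' b = 0.
  apply: IH => //; move/(congr1 (fun v => ev F *: v)): E.
  rewrite scaler0 scaler_sumr => E; rewrite -[RHS]E.
  transitivity (\sum_(i < b.+2) \sum_(e < b.+1 | (e < i)%N)
      d (q * e)%N *: (ev (H (i - e)%N) *: u i)).
    rewrite [RHS](exchange_big_dep xpredT) //=.
    by apply: eq_bigr => e _; rewrite scaler_sumr.
  apply: eq_bigr => i _; rewrite scalerA ev_divpowq scaler_suml.
  rewrite big_ord_recl /= subn0 muln0 expr0 scale1r nderivn0.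
  rewrite -[(_ * ev F) *: _]scalerA (Zu i).2 scaler0 add0r.
  rewrite [RHS](reindex_inj rev_ord_inj) /=.
  have le_ib : (i <= b.+1)%N by rewrite -ltnS.
  rewrite -(big_ord_widen _ (fun e => d (q * e)%N *: (ev (H (i - e)%N) *: u i))) //.
  apply: eq_bigr => e _; rewrite /bump leq0n add1n -subSn //.
  by rewrite subSS ?subKn ?scalerA // ltnW.
rewrite /u' (bigD1 ord_max) //= big1 ?addr0; last first.
  move=> i /andP[lt_bi /eqP ne]; case: ne; apply: val_inj => /=.
  by case: i lt_bi => /=; lia.
rewrite subSnn /H muln1 linearZ /= => E0; apply: F_inj; first by case: (Zu b.+1).
move/(congr1 (fun v => rho ((-1) ^+ q) *: v)): E0.
rewrite scaler0 !scalerA mulrA -rmorphM -exprMn mulrNN mulr1 expr1n rmorph1 mul1r //.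
Qed.

Lemma divpowq_free (B : nat) (u : nat -> M) : (forall i, polyker (u i)) ->
  \sum_(i < B) d (q * i)%N *: u i = 0 -> forall i, (i < B)%N -> u i = 0.
Proof.
move=> Zu; elim: B => // B IH E i; rewrite ltnS leq_eqVlt.
have uB := divpowq_top Zu E.
case/predU1P => [->//|]; apply: IH.
by move: E; rewrite big_ord_recr /= uB scaler0 addr0.
Qed.

(** Induction on m: d_(j+1) x = x d_(j+1) + d_j reproduces Pascal's rule. *)
Lemma divpow_xn (j m : nat) (w : M) : polykerd w -> (j < q)%N ->
  d j *: (x ^+ m *: w) = ('C(m, j)%:R * x ^+ (m - j)) *: w.
Proof.
case=> Zw dw; elim: m j => [|m IH] [|j] jq.
- by rewrite d0 scale1r bin0 mul1r.
- by rewrite expr0 scale1r dw // bin0n mul0r scale0r.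
- by rewrite d0 scale1r bin0 mul1r.
have -> : d j.+1 *: (x ^+ m.+1 *: w) =
    x *: (d j.+1 *: (x ^+ m *: w)) + d j *: (x ^+ m *: w).
  by rewrite exprS !scalerA -scalerDl !mulrA xd mulrBl subrK.
rewrite !IH // 1?ltnW // binS subSS natrD mulrDl scalerDl scalerA; congr (_ + _).
(* When m <= j the exponent m - (j + 1) is truncated, but its binomial coefficient is zero. *)
have [lt_jm|le_mj] := ltnP j m.
  by rewrite -(subnSK lt_jm) exprS !mulrA -(commr_nat x).
by rewrite bin_small // !mul0r mulr0.
Qed.

(** To isolate [w c], apply d_(q-1-c): terms a < c vanish by induction, terms a > c by [bin_carry],
    and the term c becomes +- d_(q-1) x^(q-1) w_c = +- w_c. *)
Lemma divpow_lt_free (w : nat -> M) : (forall a, polykerd (w a)) ->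
  \sum_(a < q) d a *: (x ^+ q.-1 *: w a) = 0 -> forall a, (a < q)%N -> w a = 0.
Proof.
move=> Zw E; elim/ltn_ind => c IH cq.
move/(congr1 (fun u => d (q.-1 - c)%N *: u)): E.
rewrite scaler0 scaler_sumr (bigD1 (Ordinal cq)) //= big1 ?addr0; last first.
  move=> a /eqP ne_ac; rewrite scalerA dM -mulr_natl.
  have [lt_ac|le_ca] := ltnP a c; first by rewrite IH // !scaler0.
  have lt_ca : (c < a)%N.
    by rewrite ltn_neqAle le_ca andbT; apply/eqP => E; apply/ne_ac/val_inj.
  by rewrite (@bin_carry D p k) // ?mul0r ?scale0r //; move: (ltn_ord a); lia.
rewrite scalerA dM subnK; last by rewrite -ltnS prednK.
rewrite -mulr_natl (@bin_pred D p k) //; last by lia.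
rewrite -scalerA divpow_xn ?prednK // subnn binn mulr1 scale1r.
move/(congr1 (fun v => (-1) ^+ (q.-1 - c)%N *: v)).
by rewrite scaler0 scalerA -expr2 sqrr_sign scale1r.
Qed.

(** Write j = a + q b with a < q. By Lucas d_j = d_(qb) d_a, so grouping by b yields a relation for
    [divpowq_free], and each of its vanishing coefficients is a relation for [divpow_lt_free]. *)
Lemma divpow_free (B : nat) (w : nat -> M) : (forall j, polykerd (w j)) ->
  \sum_(j < B) d j *: (x ^+ q.-1 *: w j) = 0 -> forall j, (j < B)%N -> w j = 0.
Proof.
(* Padding by zero extends the sum to B q terms, a whole number of blocks. *)
move=> Zw E j ltjB; pose w' i := if (i < B)%N then w i else 0.
have Z0 : polykerd 0.
  by split; [split|] => // *; rewrite scaler0.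
have Zw' i : polykerd (w' i) by rewrite /w'; case: ifP.
suff: w' j = 0 by rewrite /w' ltjB.
pose u b := \sum_(a < q) d a *: (x ^+ q.-1 *: w' (a + q * b)%N).
have Zu b : polyker (u b).
  apply: polyker_sum => a _; apply: polyker_divpow => //.
  rewrite -(horner_morphX x_rho) -rmorphXn; apply: polyker_ev.
  by case: (Zw' (a + q * b)%N).
have: \sum_(b < B) d (q * b)%N *: u b = 0.
  transitivity (\sum_(0 <= i < B * q) d i *: (x ^+ q.-1 *: w' i)).
    rewrite big_nat_mul big_mkord; apply: eq_bigr => b _.
    rewrite -{1}[(b * q)%N]add0n big_addn (_ : (_ - _ = q)%N) ?big_mkord; last first.
      by rewrite mulSn addnK.
    rewrite scaler_sumr; apply: eq_bigr => a _.
    rewrite scalerA dM -mulr_natl (mulnC b) (addnC (q * b)%N).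
    rewrite -[in X in 'C(_, X)](add0n (q * b)%N) (bin_lucas charD) // bin0 binn.
    by rewrite mul1r.
  rewrite (@big_cat_nat _ _ _ B) //=; last by rewrite leq_pmulr.
  rewrite [X in _ + X]big_nat [X in _ + X]big1 ?addr0; last first.
    by move=> i /andP[leBi _]; rewrite /w' ltnNge leBi !scaler0.
  by rewrite -[RHS]E big_mkord; apply: eq_bigr => i _; rewrite /w' ltn_ord.
move/(divpowq_free Zu) => u0; rewrite (divn_eq j q) addnC mulnC.
apply: (@divpow_lt_free (fun a => w' (a + q * (j %/ q))%N)) => //.
  by apply: u0; apply: leq_ltn_trans ltjB; apply: leq_div.
by rewrite ltn_mod.
Qed.

End Torsion.
End DividedPowerVariable.

(** * Free vectors in several variables *)

Section FreeVector.
Variables (D : nzRingType) (M : lmodType D) (I : eqType).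
Variables (x : I -> D) (d : I -> nat -> D).
Hypothesis d0 : forall i, d i 0%N = 1.
Hypothesis dM : forall i a b, d i a * d i b = d i (a + b)%N *+ 'C(a + b, a).
Hypothesis xd : forall i j, x i * d i j.+1 = d i j.+1 * x i - d i j.
Hypothesis xx : forall i k, GRing.comm (x i) (x k).
Hypothesis xdC : forall i k j, i != k -> GRing.comm (x i) (d k j).
Hypothesis ddC : forall i k a b, i != k -> GRing.comm (d i a) (d k b).

(** A basis of the [i]-th factor of Lambda_epsilon, with [true] standing for epsilon_i = 1. *)
Definition lambda_gen (e : I -> bool) (i : I) (j : nat) : D :=
  if e i then x i ^+ j else d i j.

(* The coefficients [c] are indexed by the list of exponents along [s]. *)
Fixpoint nested_sum (A : Type) (rho : A -> D) (e : I -> bool) (s : seq I) (B : nat)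
    (v : M) (c : seq nat -> A) : M :=
  if s is i :: s' then
    \sum_(j < B) lambda_gen e i j *:
      nested_sum rho e s' B v (fun al => c (nat_of_ord j :: al))
  else rho (c [::]) *: v.

Lemma eq_nested_sum A (rho : A -> D) e e' s B v c : {in s, e =1 e'} ->
  nested_sum rho e s B v c = nested_sum rho e' s B v c.
Proof.
elim: s c => //= i s IH c ee'; apply: eq_bigr => j _.
rewrite IH; first by rewrite /lambda_gen ee' ?mem_head.
by move=> k ks; apply: ee'; rewrite inE ks orbT.
Qed.

Lemma nested_sum_comm A (rho : A -> D) e s B v c (y : D) :
  (forall a, GRing.comm y (rho a)) ->
  (forall i j, i \in s -> GRing.comm y (lambda_gen e i j)) ->
  y *: nested_sum rho e s B v c = nested_sum rho e s B (y *: v) c.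
Proof.
move=> yr; elim: s c => /= [|i s IH] c ys; first by rewrite !scalerA yr.
rewrite scaler_sumr; apply: eq_bigr => j _.
rewrite scalerA ys ?mem_head // -scalerA IH // => k l ks.
by apply: ys; rewrite inE ks orbT.
Qed.

(** Trades coefficients in A[y] for an outer sum over powers of [y], which may be pulled out because
    [y] commutes with the generators along [s]. *)
Lemma nested_sum_poly (A : idomainType) (rho : {rmorphism A -> D}) (y : D)
    (yr : commr_rmorph rho y) e s B v c :
  (forall i j, i \in s -> GRing.comm y (lambda_gen e i j)) ->
  nested_sum (horner_morph yr) e s B v (fun al => \poly_(j < B) c j al) =
  \sum_(j < B) y ^+ j *: nested_sum rho e s B v (c j).
Proof.
elim: s c => /= [|i s IH] c ys.
  rewrite poly_def linear_sum scaler_suml; apply: eq_bigr => j _.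
  rewrite -mul_polyC rmorphM rmorphXn /= horner_morphX horner_morphC scalerA.
  by congr (_ *: _); apply/commrX/commr_sym/yr.
under [RHS]eq_bigr => l _ do rewrite scaler_sumr.
rewrite exchange_big; apply: eq_bigr => j _.
rewrite IH => [|k l ks]; last by apply: ys; rewrite inE ks orbT.
rewrite scaler_sumr; apply: eq_bigr => l _; rewrite !scalerA; congr (_ *: _).
by apply/commrX/commr_sym/ys/mem_head.
Qed.

Lemma nested_sum_closed A (rho : A -> D) e s B v c (N : M -> Prop) :
  N 0 -> (forall u w, N u -> N w -> N (u + w)) ->
  (forall a, N (rho a *: v)) ->
  (forall i j u, i \in s -> N u -> N (lambda_gen e i j *: u)) ->
  N (nested_sum rho e s B v c).
Proof.
move=> N0 ND Nr; elim: s c => [|i s IH] c /= Nl //.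
apply: big_ind => // j _; apply: (Nl) (mem_head _ _) _.
by apply: IH => k l u ks; apply: Nl; rewrite inE ks orbT.
Qed.

Lemma lambda_gen_comm_x e i k j : i != k -> GRing.comm (x i) (lambda_gen e k j).
Proof.
by move=> ik; rewrite /lambda_gen; case: ifP => _; [apply: commrX|apply: xdC].
Qed.

(** [A] and [N] are arbitrary because the induction on [s] changes them: each variable either
    enlarges [A] or shrinks [N]. The conclusion is the independence over [A] of the monomials of
    Lambda_epsilon applied to [v]. *)
Lemma free_vector (p : nat) (s : seq I) (A : idomainType)
    (rho : {rmorphism A -> D}) (N : M -> Prop) :
  uniq s -> p \in [pchar A] ->
  (forall i a, i \in s -> GRing.comm (x i) (rho a)) ->
  (forall i j a, i \in s -> GRing.comm (d i j) (rho a)) ->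
  N 0 -> (forall u v, N u -> N v -> N (u + v)) ->
  (forall a u, N u -> N (rho a *: u)) ->
  (forall i u, i \in s -> N u -> N (x i *: u)) ->
  (forall i j u, i \in s -> N u -> N (d i j *: u)) ->
  (forall a u, N u -> rho a *: u = 0 -> a = 0 \/ u = 0) ->
  (exists2 u, N u & u != 0) ->
  exists e v, N v /\ forall B c, nested_sum rho e s B v c = 0 ->
    forall al, size al = size s -> all (gtn B) al -> c al = 0.
Proof.
elim: s A rho N => [|i s IH] A rho N.
  move=> _ _ _ _ _ _ _ _ _ tf [u Nu u0]; exists (fun=> true), u.
  split=> // B c /(tf _ _ Nu)[c0|u00]; last by rewrite u00 eqxx in u0.
  by case.
move=> /= /andP[nis us] charA xr dr N0 ND Nr Nx Nd tf Nnz.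
have x_rho : commr_rmorph rho (x i) by move=> a; apply/xr/mem_head.
have ne k : k \in s -> i != k by apply: contraTneq => <-.
have sub k : k \in s -> k \in i :: s by rewrite inE => ->; rewrite orbT.
have xi : i \in i :: s by exact: mem_head.
have d_rho j a : GRing.comm (d i j) (rho a) by apply: dr.
pose ev := horner_morph x_rho.
have Nev F u : N u -> N (ev F *: u).
  by apply: closed_horner => // ? ?; apply: Nx.
have ev_C (y : D) : GRing.comm y (x i) -> (forall a, GRing.comm y (rho a)) ->
    forall F, GRing.comm y (ev F).
  rewrite /ev => yx yr; elim/poly_ind => [|F c IHF].
    by rewrite rmorph0; apply: commr0.
  rewrite rmorphD rmorphM /= horner_morphX horner_morphC.
  by apply: commrD; [apply: commrM|].
have [tfp|/existsNP[F0 /existsNP[u0 /not_implyP[Nu0 /not_implyP[Fu0 /not_orP[F00 u00]]]]]] :=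
    pselect (forall F u, N u -> ev F *: u = 0 -> F = 0 \/ u = 0).
  have [e [v [Nv free]]] : exists e v, N v /\ forall B c, nested_sum ev e s B v c = 0 ->
      forall al, size al = size s -> all (gtn B) al -> c al = 0.
    apply: (IH {poly A} (horner_morph x_rho) N) => //.
    - by rewrite pchar_poly.
    - move=> k F ks; apply: ev_C => [|a]; first exact: xx.
      exact/xr/sub.
    - move=> k j F ks; apply: ev_C => [|a]; last exact/dr/sub.
      exact/commr_sym/xdC/ne.
    - by move=> k u ks; apply/Nx/sub.
    - by move=> k j u ks; apply/Nd/sub.
  exists (fun k => (k == i) || e k), v; split=> // B c.
  rewrite {1}/lambda_gen eqxx /= => E [//|j al] [szal] /= /andP[ltjB allB].
  (* A relation over [A] between powers of [x i] is a single relation over A[x_i] with polynomial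
     coefficients. *)
  have := free B (fun al => \poly_(j < B) c (j :: al)).
  rewrite (@nested_sum_poly _ _ _ _ _ _ _ _ (fun j al => c (j :: al))); last first.
    by move=> k l ks; apply/lambda_gen_comm_x/ne.
  rewrite (eq_bigr _ (fun j _ => congr1 _
    (@eq_nested_sum _ rho e (fun k => (k == i) || e k) s B v _ _))).
    rewrite E => /(_ erefl al szal allB)/(congr1 (fun F : {poly A} => F`_j)).
    by rewrite coef_poly ltjB coef0.
  by move=> ? _ k /ne; rewrite eq_sym => /negPf->.
have [F [u [Nu Fu F_neq0 u_neq0 Fmin]]] : exists F u, [/\ N u, ev F *: u = 0,
    F != 0, u != 0 & forall G w, N w -> ev G *: w = 0 -> (size G < size F)%N ->
    G = 0 \/ w = 0].
  have : exists n, `[<exists F u,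
      [/\ N u, ev F *: u = 0, F != 0, u != 0 & size F = n]>].
    exists (size F0); apply/asboolP; exists F0, u0.
    by split=> //; apply/eqP.
  move=> ex; case: (ex_minnP ex) => n /asboolP[F [u [Nu Fu Fn0 un0 sF]]] nmin.
  exists F, u; split=> // G w Nw Gw; rewrite sF => ltGn.
  have [->|G0] := eqVneq G 0; [by left|right]; apply/eqP/contraT => w0.
  by have := nmin (size G); rewrite leqNgt ltGn; apply; apply/asboolP; exists G, w.
(* F is not constant, since [A] itself acts without torsion. *)
have F_gt1 : (1 < size F)%N.
  rewrite ltnNge; apply/negP => /size1_polyC EF.
  move: Fu F_neq0; rewrite EF /ev horner_morphC polyC_eq0 => /(tf _ _ Nu)[->|z].
    by rewrite eqxx.
  by rewrite z eqxx in u_neq0.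
have [k Fk F_div] := nderivn_pchar charA F_gt1.
(* [F] has minimal size among the polynomials killing a nonzero vector of [N]. *)
have F_inj w : N w -> ev F^`N(p ^ k) *: w = 0 -> w = 0.
  move=> Nw Fw; case: (Fmin _ _ Nw Fw) => // [|z]; last by rewrite z eqxx in Fk.
  apply: leq_ltn_trans (size_poly _ _) _.
  by rewrite ltn_subrL expn_gt0 prime_gt0 ?(pcharf_prime charA) //= ltnW.
have Ndi j w : N w -> N (d i j *: w) by apply: Nd.
have Nxi w : N w -> N (x i *: w) by apply: Nx.
pose N1 := polykerd (d i) x_rho p k F N.
have Zu : polyker x_rho F N u by [].
have N1nz := polykerd_neq0 (d0 i) (dM i) (xd i) d_rho charA F_div Ndi Zu u_neq0.
(* Coefficients and operators in the remaining variables preserve [N1], which makes the recursive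
   call on [N1] legitimate. *)
have N1C y w : (forall a, GRing.comm y (rho a)) -> GRing.comm y (x i) ->
    (forall j, GRing.comm y (d i j)) -> (forall w, N w -> N (y *: w)) ->
    N1 w -> N1 (y *: w).
  move=> yr yx yd Ny [[Nw Fw] dw]; split; first split; first exact: Ny.
    by rewrite scalerA -ev_C // -scalerA Fw scaler0.
  by move=> a aq; rewrite scalerA -yd -scalerA dw // scaler0.
have N1sum (u1 u2 : M) : N1 u1 -> N1 u2 -> N1 (u1 + u2).
  move=> [[? Fw1] dw1] [[? Fw2] dw2]; split; first split; first exact: ND.
    by rewrite scalerDr Fw1 Fw2 addr0.
  by move=> a aq; rewrite scalerDr dw1 // dw2 // addr0.
have N10 : N1 0 by split; [split|] => // *; rewrite scaler0.
have N1r a w : N1 w -> N1 (rho a *: w).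
  apply: N1C => [b|||?] //; last exact: Nr.
  - by rewrite /GRing.comm -!rmorphM mulrC.
  - exact/commr_sym/x_rho.
  - by move=> j; apply/commr_sym/d_rho.
have N1x k' w : k' \in s -> N1 w -> N1 (x k' *: w).
  move=> ks; apply: N1C => [a|||?]; [exact/xr/sub|exact: xx| |exact/Nx/sub].
  by move=> j; apply: xdC; rewrite eq_sym; apply: ne.
have N1d k' j w : k' \in s -> N1 w -> N1 (d k' j *: w).
  move=> ks; apply: N1C => [a|||?]; [exact/dr/sub| | |exact/Nd/sub].
    exact/commr_sym/xdC/ne.
  by move=> l; apply: ddC; rewrite eq_sym; apply: ne.
have [e [v [N1v free]]] : exists e v, N1 v /\ forall B c,
    nested_sum rho e s B v c = 0 ->
    forall al, size al = size s -> all (gtn B) al -> c al = 0.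
  apply: (IH A rho N1) => //.
  - by move=> l a ls; apply/xr/sub.
  - by move=> l j a ls; apply/dr/sub.
  - by move=> a w [[Nw _] _]; apply: tf.
exists (fun l => (l != i) && e l), (x i ^+ (p ^ k).-1 *: v); split.
  by rewrite -(horner_morphX x_rho) -rmorphXn; apply: Nev; case: N1v => -[].
move=> B c; rewrite {1}/lambda_gen eqxx /= => E [//|j al] [szal] /= /andP[ltjB allB].
(* [w j] collects the terms containing [d i j]. As x_i^(q-1) commutes with the other generators, the
   relation reads sum_j d_j x_i^(q-1) w_j = 0, to which [divpow_free] applies. *)
pose w j := nested_sum rho e s B v (fun al => c (j :: al)).
have N1w l : N1 (w l).
  apply: nested_sum_closed => // [a|k' b y ks N1y]; first exact: N1r.
  rewrite /lambda_gen; case: ifP => _; last exact: N1d.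
  elim: b => [|b IHb]; first by rewrite scale1r.
  by rewrite exprS -scalerA; apply: N1x.
apply: (free B (fun al => c (j :: al))) => //.
have Nri a y : N y -> N (rho a *: y) by apply: Nr.
apply: (divpow_free (d0 i) (dM i) (xd i) d_rho charA F_div N0 ND Nri Nxi Ndi
  F_inj N1w _ ltjB).
rewrite -[RHS]E; apply: eq_bigr => b _; congr (_ *: _).
rewrite /w nested_sum_comm; last 2 first.
- by move=> a; apply/commr_sym/commrX/commr_sym/x_rho.
- by move=> l m ls; apply/commr_sym/commrX/commr_sym/lambda_gen_comm_x/ne.
by apply: eq_nested_sum => l /ne; rewrite eq_sym => ->.
Qed.

End FreeVector.

(** * Spans and dimension *)

Section LinearSpan.
Variables (K : fieldType) (V : lmodType K).
Implicit Types (S W : set V).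

Definition is_subspace W := W 0 /\ forall c u v, W u -> W v -> W (c *: u + v).

Lemma subspace_sum W (I : Type) (s : seq I) (P : pred I) (c : I -> K) (u : I -> V) :
  is_subspace W -> (forall i, P i -> W (u i)) -> W (\sum_(i <- s | P i) c i *: u i).
Proof.
move=> [W0 WD] Wu; apply: (big_rec W) => // i v Pi Wv.
by apply: WD => //; apply: Wu.
Qed.

Lemma subspaceD W u v : is_subspace W -> W u -> W v -> W (u + v).
Proof. by move=> [_ WD] Wu Wv; rewrite -[u]scale1r; apply: WD. Qed.

Lemma subspaceZ W c u : is_subspace W -> W u -> W (c *: u).
Proof. by move=> [W0 WD] Wu; rewrite -[_ *: _]addr0; apply: WD. Qed.

Lemma sub_lin_span S : S `<=` lin_span S.
Proof.
move=> v Sv; exists 1%N, (fun=> 1), (fun=> v); split=> //.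
by rewrite big_ord1 scale1r.
Qed.

Lemma subspace_lin_span S : is_subspace (lin_span S).
Proof.
split; first by exists 0%N, (fun=> 0), (fun=> 0); split=> [[]//|]; rewrite big_ord0.
move=> a _ _ [r [c [u [Su ->]]]] [t [e [w [Sw ->]]]].
exists (r + t)%N.
exists (fun i => match fintype.split i with inl j => a * c j | inr j => e j end).
exists (fun i => match fintype.split i with inl j => u j | inr j => w j end).
split=> [i|]; first by case: (fintype.split i).
rewrite big_split_ord scaler_sumr; congr (_ + _); apply: eq_bigr => i _.
  by rewrite (unsplitK (inl _ i)) scalerA.
by rewrite (unsplitK (inr _ i)).
Qed.

Lemma lin_span_min S W : is_subspace W -> S `<=` W -> lin_span S `<=` W.
Proof.
move=> subW SW _ [r [c [u [Su ->]]]].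
by apply: subspace_sum => // i _; apply/SW/Su.
Qed.

Lemma lin_spanS S W : S `<=` W -> lin_span S `<=` lin_span W.
Proof.
move=> SW; apply: lin_span_min; first exact: subspace_lin_span.
exact: subset_trans (@sub_lin_span _).
Qed.

Lemma lin_span_range (T : finType) (g : T -> V) v : lin_span (range g) v ->
  exists c : T -> K, v = \sum_t c t *: g t.
Proof.
move: v; apply: lin_span_min => [|_ [t _ <-]]; last first.
  exists (fun i => (i == t)%:R); rewrite (bigD1 t) //= eqxx scale1r.
  by rewrite big1 ?addr0 // => i /negPf->; rewrite scale0r.
split; first by exists (fun=> 0); rewrite big1 // => i _; rewrite scale0r.
move=> a _ _ [c ->] [e ->]; exists (fun t => a * c t + e t).
rewrite scaler_sumr -big_split; apply: eq_bigr => t _.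
by rewrite scalerDl scalerA.
Qed.

(** The s x #|T| matrix of coordinates has trivial left kernel, hence rank s. *)
Lemma lin_indep_leq (T : finType) (g : T -> V) s (b : 'I_s -> V) :
  lin_indep b -> (forall i, lin_span (range g) (b i)) -> (s <= #|T|)%N.
Proof.
move=> indb spb; have [c Ec] := choice (fun i => lin_span_range (spb i)).
pose C := \matrix_(i < s, j < #|T|) c i (enum_val j).
suff <-: \rank C = s by apply: rank_leq_col.
apply/eqP/row_freeP; apply/row_freeP; rewrite -kermx_eq0; apply/rowV0P => u.
move/sub_kermxP => uC; apply/rowP => i; rewrite mxE.
apply: (indb (fun i => u 0 i)).
under eq_bigr => j _ do rewrite Ec scaler_sumr.
rewrite exchange_big big1 // => t _.
under eq_bigr => j _ do rewrite scalerA.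
rewrite -scaler_suml (_ : \sum_j _ = 0) ?scale0r //.
have /rowP/(_ (enum_rank t)) := uC; rewrite !mxE => E; rewrite -[RHS]E.
by apply: eq_bigr => j _; rewrite mxE enum_rankK.
Qed.

Lemma lin_indep_extend s (b : 'I_s -> V) v : lin_indep b ->
  ~ lin_span (range b) v ->
  lin_indep (fun i : 'I_s.+1 => if unlift ord_max i is Some j then b j else v).
Proof.
move=> indb nv c; rewrite big_ord_recr /= unlift_none.
have Ew i : widen_ord (leqnSn s) i = lift ord_max i.
  exact/val_inj/esym/lift_max.
under eq_bigr => i _ do rewrite Ew liftK.
move=> E.
have c0 : c ord_max = 0.
  apply: contra_notP nv => /eqP cn0.
  rewrite (_ : v = \sum_(i < s) (- (c ord_max)^-1 * c (lift ord_max i)) *: b i).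
    apply: subspace_sum; first exact: subspace_lin_span.
    by move=> i _; apply: sub_lin_span; exists i.
  under eq_bigr => i _ do rewrite -scalerA.
  rewrite -scaler_sumr; move/eqP: E; rewrite addr_eq0 => /eqP->.
  by rewrite scalerN scaleNr opprK scalerA mulVf // scale1r.
move=> i; case: (unliftP ord_max i) => [j ->|-> //].
by apply: (indb (fun j => c (lift ord_max j))); rewrite -[RHS]E c0 scale0r addr0.
Qed.

(** An independent family in [W] of maximal length, bounded by #|T|, spans [W]: otherwise
    [lin_indep_extend] would lengthen it. *)
Lemma has_dim_sub (T : finType) (g : T -> V) W : is_subspace W ->
  W `<=` lin_span (range g) ->
  exists2 r, (r <= #|T|)%N & has_dim W r.
Proof.
move=> subW sWg.
pose P s := `[<exists b : 'I_s -> V, lin_indep b /\ forall i, W (b i)>].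
have P0 : exists s, P s.
  by exists 0%N; apply/asboolP; exists (fun=> 0); split=> [c _|] [].
have Pb s : P s -> (s <= #|T|)%N.
  move/asboolP=> [b [indb Wb]]; apply: lin_indep_leq indb _ => i.
  exact/sWg/Wb.
case: (ex_maxnP P0 Pb) => r Pr rmax; exists r; first exact: Pb.
have /asboolP[b [indb Wb]] := Pr; exists b; split=> //.
apply/seteqP; split=> [v Wv|]; last by apply: lin_span_min => // _ [i _ <-].
apply: contrapT => nv; suff /rmax : P r.+1 by rewrite ltnn.
apply/asboolP; eexists; split; first exact: lin_indep_extend nv.
by move=> i /=; case: (unlift ord_max i).
Qed.

Lemma has_dim_inj W r s : has_dim W r -> has_dim W s -> r = s.
Proof.
move=> [b [indb Eb]] [c [indc Ec]]; apply/eqP; rewrite eqn_leq.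
have := lin_indep_leq (g := c) indb; have := lin_indep_leq (g := b) indc.
rewrite !card_ord -Eb -Ec => -> => [-> //|] i; [rewrite Eb|rewrite Ec].
  by apply: sub_lin_span; exists i.
by apply: sub_lin_span; exists i.
Qed.

Lemma dimKE W r : has_dim W r -> dimK W = r.
Proof. by move=> Wr; apply: xget_unique => // s /has_dim_inj; apply. Qed.

Lemma dimK_leq (T : finType) (g : T -> V) W : is_subspace W ->
  W `<=` lin_span (range g) -> (dimK W <= #|T|)%N.
Proof. by move=> sW sWg; have [r ler /dimKE->] := has_dim_sub sW sWg. Qed.

(** The finite spanning family excludes the junk value 0 of [dimK]. *)
Lemma lin_indep_dimK (T : finType) (g : T -> V) W s (b : 'I_s -> V) :
  is_subspace W -> W `<=` lin_span (range g) ->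
  lin_indep b -> (forall i, W (b i)) -> (s <= dimK W)%N.
Proof.
move=> sW sWg indb Wb; have [r _ Wr] := has_dim_sub sW sWg; rewrite (dimKE Wr).
case: Wr => c [indc Ec]; rewrite -[r]card_ord; apply: (lin_indep_leq (g := c)) indb _ => i.
by rewrite -Ec.
Qed.

Lemma has_dim1 (v : V) : v != 0 -> has_dim (lin_span [set v]) 1.
Proof.
move=> v0; exists (fun=> v); split=> [c|].
  rewrite big_ord1 => /eqP; rewrite scaler_eq0 (negPf v0) orbF => /eqP E i.
  by rewrite ord1.
by congr lin_span; apply/seteqP; split=> [_ ->|_ [_ _ <-]] //; exists ord0.
Qed.

End LinearSpan.

(** * The canonical filtration *)

Section Operators.
Variables (K : fieldType) (n : nat).
Local Notation D := (diffOp K n).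
Local Notation mX m := (mpolyX K m).
Local Notation e1 i := (mnm1 i).
Implicit Types (a b d : D) (m beta gamma : multinom n) (i k : 'I_n) (j : nat).

Lemma mnm_rec (P : multinom n -> Prop) : P mnm0 ->
  (forall i m, P m -> P (mnm_add (e1 i) m)) -> forall m, P m.
Proof.
move=> P0 PD m; have [l] := ubnP (mdeg m); elim: l m => // l IH m lt_ml.
have [/eqP|] := eqVneq (mdeg m) 0%N; first by rewrite mdeg_eq0 => /eqP->.
rewrite mdegE sum_nat_eq0 negb_forall => /existsP[i /= mi].
have le_im : lem (e1 i) m by rewrite lep1mP.
rewrite -(submK le_im) addmC; apply: PD; apply: IH.
move: lt_ml; rewrite -{1}(submK le_im) mdegD mdeg1; lia.
Qed.

Definition xop i : D := mulop (mX (e1 i)).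
Definition dop i j : D := divop K (mnm_muln (e1 i) j).

Lemma diffop_eqX a b : (forall m, a (mX m) = b (mX m)) -> a = b.
Proof.
by move=> ab; apply/val_inj/linear_eq_X => //; apply: diffop_is_linear.
Qed.

Lemma diffopD a q r : a (q + r) = a q + a r.
Proof. by have := diffop_is_linear a 1 q r; rewrite !scale1r. Qed.

Lemma diffopZ a (c : K) q : a (c *: q) = c *: a q.
Proof.
have := diffop_is_linear a c q 0.
by rewrite (linear_fun0 (diffop_is_linear a)) !addr0.
Qed.

Lemma diffop_sum a (I : Type) (s : seq I) (F : I -> mpoly n K) :
  a (\sum_(i <- s) F i) = \sum_(i <- s) a (F i).
Proof.
elim: s => [|t s IH]; last by rewrite !big_cons diffopD IH.
by rewrite !big_nil (linear_fun0 (diffop_is_linear a)).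
Qed.

Lemma diffopME a b q : (a * b) q = a (b q). Proof. by []. Qed.

Lemma diffopZE (c : K) a q : (c *: a) q = c *: a q. Proof. by []. Qed.

Lemma divopX beta m : divop K beta (mX m) =
  (\prod_(i < n) 'C(m i, beta i))%N%:R *: mX (mnm_sub m beta).
Proof. exact: divpowX. Qed.

Lemma divop0 : divop K (mnm0 : multinom n) = 1 :> D.
Proof.
apply: diffop_eqX => m; rewrite /= divpowX big1 => [|i _]; last by rewrite mnm0E bin0.
by rewrite scale1r; congr mpolyX; apply/mnmP => i; rewrite mnmBE mnm0E subn0.
Qed.

(** Both sides equal m! / (b! c! (m - b - c)!), or vanish when b + c > m. *)
Lemma bin_mul_bin (m b c : nat) :
  ('C(m, c) * 'C(m - c, b) = 'C(b + c, b) * 'C(m, b + c))%N.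
Proof.
have [le_bcm|lt_mbc] := leqP (b + c) m; last first.
  rewrite [X in (_ = _ * X)%N]bin_small // muln0.
  have [lt_mc|le_cm] := ltnP m c; first by rewrite bin_small.
  by rewrite [X in (_ * X)%N]bin_small ?muln0 //; lia.
apply/eqP; rewrite -(eqn_pmul2r (fact_gt0 b)) -(eqn_pmul2r (fact_gt0 c)).
rewrite -(eqn_pmul2r (fact_gt0 (m - (b + c)))); apply/eqP.
have E1 := bin_fact le_bcm.
have E2 := bin_fact (leq_addr c b); rewrite addKn in E2.
have le_cm : (c <= m)%N by lia.
have E3 := bin_fact le_cm.
have le_b : (b <= m - c)%N by lia.
have E4 := bin_fact le_b.
rewrite (_ : m - c - b = m - (b + c))%N in E4; last by lia.
transitivity m`!%N; last by rewrite -E1 -E2; ring.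
by rewrite -E3 -E4; ring.
Qed.

Lemma divopM beta gamma : divop K beta * divop K gamma =
  (\prod_(i < n) 'C(beta i + gamma i, beta i))%N%:R *: divop K (mnm_add beta gamma).
Proof.
apply: diffop_eqX => m; rewrite diffopME diffopZE !divopX diffopZ divopX !scalerA.
rewrite -!natrM -!big_split /=; congr (_%:R *: mpolyX _ _).
  by apply: eq_bigr => i _; rewrite mnmBE mnmDE bin_mul_bin.
by apply/mnmP => i; rewrite !mnmBE mnmDE addnC subnDA.
Qed.

Lemma divop_comm beta gamma : GRing.comm (divop K beta) (divop K gamma).
Proof.
rewrite /GRing.comm !divopM; congr (_%:R *: divop _ _).
  apply: eq_bigr => i _; rewrite -[in LHS]bin_sub ?leq_addr // addKn.
  by rewrite addnC.
by apply/mnmP => i; rewrite !mnmDE addnC.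
Qed.

Lemma dop0 i : dop i 0 = 1.
Proof.
by rewrite -divop0; congr divop; apply/mnmP => k; rewrite mulmnE mnm0E muln0.
Qed.

Lemma dopM i (j l : nat) : dop i j * dop i l = dop i (j + l) *+ 'C(j + l, j).
Proof.
rewrite divopM -scaler_nat; congr (_%:R *: divop _ _).
  rewrite (bigD1 i) //= big1 ?muln1 => [|k /negPf ki].
    by rewrite !mulmnE mnm1E eqxx !mul1n.
  by rewrite !mulmnE mnm1E eq_sym ki !mul0n.
by apply/mnmP => k; rewrite mnmDE !mulmnE mulnDr.
Qed.

Lemma dop_comm i k (j l : nat) : GRing.comm (dop i j) (dop k l).
Proof. exact: divop_comm. Qed.

Lemma mulop_comm f g : GRing.comm (mulop f : D) (mulop g).
Proof. by apply: diffop_inj => q /=; rewrite mulrCA. Qed.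

Lemma mulopM f g : (mulop f : D) * mulop g = mulop (f * g).
Proof. by apply: diffop_inj => q /=; rewrite mulrA. Qed.

Lemma divop_xop beta i : divop K beta * xop i - xop i * divop K beta =
  if beta i == 0%N then 0 else divop K (mnm_sub beta (e1 i)).
Proof.
apply: diffop_inj => q; have /(congr1 (fun f => f q)) := commop_divpow K i beta.
rewrite /commop => E.
transitivity (divpow beta (mX (e1 i) * q) - mX (e1 i) * divpow beta q) => //.
by rewrite E; case: ifP.
Qed.

Lemma xop_dop i j : xop i * dop i j.+1 = dop i j.+1 * xop i - dop i j.
Proof.
have := divop_xop (mnm_muln (e1 i) j.+1) i; rewrite mulmnE mnm1E eqxx mul1n /=.
rewrite (_ : mnm_sub _ _ = mnm_muln (e1 i) j) => [E|]; first by rewrite -[dop i j]E subKr.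
by apply/mnmP => k; rewrite mnmBE !mulmnE mulnS addKn.
Qed.

Lemma xop_dopC i k j : i != k -> GRing.comm (xop i) (dop k j).
Proof.
move=> ik; have := divop_xop (mnm_muln (e1 k) j) i.
by rewrite mulmnE mnm1E [k == i]eq_sym (negPf ik) => /eqP; rewrite subr_eq0 => /eqP.
Qed.

Lemma xop_comm i k : GRing.comm (xop i) (xop k).
Proof. exact: mulop_comm. Qed.

Definition weyl_monomial m beta : D := mulop (mX m) * divop K beta.

Lemma canF_mono l m beta : (mdeg m + mdeg beta <= l)%N -> canF l (weyl_monomial m beta).
Proof. by move=> le; apply: sub_lin_span; exists m, beta. Qed.

Lemma canF_sub (l l' : nat) : (l <= l')%N -> @canF K n l `<=` @canF K n l'.
Proof.
move=> le; apply: lin_spanS => _ [m [beta [le' ->]]]; exists m, beta.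
by split=> //; apply: leq_trans le.
Qed.

Lemma subspace_canF l : is_subspace (@canF K n l).
Proof. exact: subspace_lin_span. Qed.

Lemma canF_mul_l (y : D) j :
  (forall m beta, canF (j + (mdeg m + mdeg beta)) (y * weyl_monomial m beta)) ->
  forall l d, canF l d -> canF (j + l) (y * d).
Proof.
move=> H l; apply: (@lin_span_min _ _ _ (fun d => canF (j + l) (y * d))).
  split=> [|c u v Fu Fv]; first by rewrite mulr0; case: (subspace_canF (j + l)).
  by rewrite mulrDr -scalerAr; case: (subspace_canF (j + l)) => _; apply.
move=> _ [m [beta [le ->]]]; apply: canF_sub (H m beta).
by rewrite leq_add2l.
Qed.

Lemma xop_canF i l d : canF l d -> canF l.+1 (xop i * d).
Proof.
rewrite -(add1n l); apply: canF_mul_l => m beta.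
rewrite /weyl_monomial mulrA mulopM -mpolyXD; apply: canF_mono.
by rewrite mdegD mdeg1 addnA.
Qed.

(** Restores the normal form by moving the divided power right through x^m, one variable at a time;
    in d_(j+1) x = x d_(j+1) + d_j neither term exceeds the allowed degree. *)
Lemma dop_canF i j l d : canF l d -> canF (j + l) (dop i j * d).
Proof.
apply: canF_mul_l => m; elim/mnm_rec: m j => [|k m IH] j beta.
  rewrite /weyl_monomial (_ : mulop _ = 1) ?mul1r; last first.
    by apply: diffop_inj => q /=; rewrite mpolyX0 mul1r.
  rewrite divopM; apply: subspaceZ; first exact: subspace_canF.
  rewrite -[divop _ _]mul1r (_ : 1 = mulop (mX mnm0)); last first.
    by apply: diffop_inj => q /=; rewrite mpolyX0 mul1r.
  apply: canF_mono; rewrite mdeg0 !add0n mdegD mdegMn mdeg1 mul1n.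
  exact: leqnn.
have -> : weyl_monomial (mnm_add (e1 k) m) beta = xop k * weyl_monomial m beta.
  by rewrite /weyl_monomial mulrA mulopM -mpolyXD.
rewrite mdegD mdeg1 -addnA add1n addnS.
have [->|ik] := eqVneq k i; last first.
  by rewrite mulrA -xop_dopC // -mulrA; apply/xop_canF/IH.
case: j => [|j]; first by rewrite dop0 mul1r; apply/xop_canF/canF_mono.
rewrite mulrA -[dop i j.+1 * _](subrK (dop i j)) -xop_dop mulrDl -mulrA.
apply: subspaceD; first exact: subspace_canF.
  exact/xop_canF/IH.
by apply: canF_sub (IH j beta); rewrite addSn; apply: leqW.
Qed.

End Operators.

(** * The canonical filtration exhausts the ring of differential operators *)

Section Exhaustion.
Variables (K : fieldType) (n : nat).
Local Notation P := (mpoly n K).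
Local Notation D := (diffOp K n).
Local Notation mX m := (mpolyX K m).
Local Notation e1 i := (mnm1 i).
Implicit Types (m beta : multinom n).

(** The commutators with the variables have smaller order and vanish by induction; [d] then commutes
    with the variables, and it kills 1. *)
Lemma diffop_lt_eq0 k (d : P -> P) : linear d -> diffop_lt k d ->
  (forall m, (mdeg m < k)%N -> d (mX m) = 0) -> d = 0.
Proof.
elim: k d => [//|k IH] d dL dk d0.
have dC i : commop d (mX (e1 i)) = 0.
  apply: IH => [||m lt_mk]; [exact: linear_commop|exact: dk|].
  by rewrite /commop -mpolyXD !d0 ?mulr0 ?subr0 ?mdegD ?mdeg1 ?add1n // ltnW.
apply: linear_eq_X => // [|m]; first by case: (is_diffop0 K n).
elim/mnm_rec: m => [|i m IHm]; first by apply: d0; rewrite mdeg0.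
have := congr1 (fun f => f (mX m)) (dC i); rewrite /commop -mpolyXD IHm.
by rewrite /= mulr0 subr0.
Qed.

(** If [beta] differs from [m], the degrees force beta_i > m_i for some i, and the i-th binomial
    vanishes. *)
Lemma divop_top m beta : (mdeg m <= mdeg beta)%N ->
  divop K beta (mX m) = (beta == m)%:R.
Proof.
move=> le_mb; rewrite divopX; have [->|ne_bm] := eqVneq beta m.
  rewrite big1 => [|i _]; last by rewrite binn.
  rewrite scale1r (_ : mnm_sub m m = mnm0) ?mpolyX0 //.
  by apply/mnmP => i; rewrite mnmBE subnn mnm0E.
suff [i lt_i] : exists i, (m i < beta i)%N.
  by rewrite (bigD1 i) //= bin_small // mul0n scale0r.
apply/existsP; apply: contraNT ne_bm; rewrite negb_exists => /forallP le_bm.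
have le' : lem beta m by apply/mnm_lepP => i; rewrite leqNgt.
have := submK le' => E; move: le_mb; rewrite -{1}E mdegD -[leqRHS]add0n leq_add2r.
by rewrite leqn0 mdeg_eq0 => /eqP E0; rewrite -E E0 add0m.
Qed.

Definition canF_union : set D := [set d | exists l, canF l d].

Lemma subspace_canF_union : is_subspace canF_union.
Proof.
split=> [|c u v [l Fu] [l' Fv]]; first by exists 0%N; case: (subspace_canF K n 0).
exists (maxn l l'); case: (subspace_canF K n (maxn l l')) => _; apply.
  by apply: canF_sub Fu; apply: leq_maxl.
by apply: canF_sub Fv; apply: leq_maxr.
Qed.

Lemma canF_union_term (g : P) beta : canF_union (mulop g * divop K beta).
Proof.
elim/mpolyind: g => [|c m g _ _ IH].
  rewrite (_ : mulop 0 = 0) ?mul0r; first by case: subspace_canF_union.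
  by apply: diffop_inj => q /=; rewrite mul0r.
rewrite (_ : mulop _ = c *: mulop (mX m) + mulop g); last first.
  by apply: diffop_inj => q /=; rewrite mulrDl -scalerAl.
rewrite mulrDl -scalerAl; case: subspace_canF_union => _; apply=> //.
by exists (mdeg m + mdeg beta)%N; apply: canF_mono.
Qed.

(* Triangularity: [divop beta] kills the monomials of degree at most [mdeg beta]
   other than [beta] itself, which it sends to 1. *)
Lemma diffop_approx (d : D) k : exists u : D, [/\ canF_union u, diffop_lt k u &
  forall m, (mdeg m < k)%N -> d (mX m) = u (mX m)].
Proof.
elim: k => [|k [u [Uu uk ud]]].
  by exists 0; split=> //; case: subspace_canF_union.
(* [t b], for b of degree k, corrects the value at x^b and leaves the other monomials of degree at
   most k alone. *)
pose t (b : bmultinom n k.+1) : D := mulop ((d - u) (mX (bmnm b))) * divop K b.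
exists (u + \sum_(b | mdeg (bmnm b) == k) t b); split.
- apply: subspaceD => //; first exact: subspace_canF_union.
  apply: big_ind => [|a b|b _]; first by case: subspace_canF_union.
    exact: (subspaceD subspace_canF_union).
  exact: canF_union_term.
- apply: diffop_ltD; first exact: diffop_ltS.
  apply: (big_ind (fun a : D => diffop_lt k.+1 a)) => [|a b|b _].
  + exact: diffop_lt0.
  + exact: diffop_ltD.
  by apply: diffop_ltM; apply: diffop_lt_divpow; apply: bmdeg.
move=> m; rewrite ltnS => le_mk.
have tE (b : bmultinom n k.+1) : mdeg b == k ->
    t b (mX m) = if bmnm b == m then (d - u) (mX m) else 0.
  move=> /eqP bk; rewrite /t diffopME divop_top ?bk //.
  by case: eqP => [->|_]; rewrite /= ?mulr1 ?mulr0.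
have -> : (u + \sum_(b | mdeg (bmnm b) == k) t b) (mX m) =
   u (mX m) + \sum_(b | mdeg (bmnm b) == k) t b (mX m).
  congr (_ + _); apply: (big_morph (fun a : D => a (mX m))) => //.
rewrite (eq_bigr _ tE) -big_mkcondr /=.
have [lt_mk|ge_mk] := ltnP (mdeg m) k.
  rewrite big1 ?addr0 ?ud // => b /andP[/eqP bk /eqP bm].
  by rewrite -bm bk ltnn in lt_mk.
have mk : mdeg m = k by apply/eqP; rewrite eqn_leq le_mk.
have lt_mk : (mdeg m < k.+1)%N by rewrite mk.
rewrite (big_pred1 (BMultinom lt_mk)); last first.
  move=> b; apply/andP/eqP => [[_ /eqP E]|->]; first exact: val_inj.
  by split=> //=; rewrite mk.
by change (d (mX m) = u (mX m) + (d (mX m) - u (mX m))); rewrite addrC subrK.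
Qed.

(** An approximation at the order of [d] agrees with [d] on enough monomials to equal it, by
    [diffop_lt_eq0]. *)
Lemma canF_exhaust (d : D) : exists l, canF l d.
Proof.
have [dL [k dk]] := is_diffop_fun d.
have [u [Uu uk ud]] := diffop_approx d k.
suff -> : d = u by [].
apply/eqP; rewrite -subr_eq0; apply/eqP/val_inj.
apply: (@diffop_lt_eq0 k); first exact: diffop_is_linear.
  by apply: diffop_ltD => //=; rewrite -scaleN1r; apply: diffop_ltZ.
by move=> m /ud E; change (d (mX m) - u (mX m) = 0); rewrite E subrr.
Qed.

End Exhaustion.

(** * Tensor subalgebras *)

Definition subalgebra (K : fieldType) (A : algType K) (C : set A) :=
  [/\ C 1, is_subspace C & forall u v, C u -> C v -> C (u * v)].

Lemma subalgebra_closed (K : fieldType) (A : algType K) (C : set A) :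
  subalgebra C -> GRing.subalg_closed (mem C).
Proof.
move=> [C1 [C0 CD] CM]; split; first exact/mem_set.
  by move=> a u v /set_mem Cu /set_mem Cv; apply/mem_set/CD.
by move=> u v /set_mem Cu /set_mem Cv; apply/mem_set/CM.
Qed.

Section Tensor.
Variables (K : fieldType) (n : nat).
Local Notation P1 := (mpoly 1 K).
Local Notation D := (diffOp K n).
Local Notation mX m := (mpolyX K m).
Local Notation e1 i := (mnm1 i).
Local Notation x0 := (mpolyX K (mnm1 (@ord0 0))).

Lemma subst1_x0 (i : 'I_n) j : subst1 i (x0 ^+ j) = mX (e1 i) ^+ j.
Proof. by rewrite /subst1 rmorphXn /= comp_mpolyXU. Qed.

Lemma subst1Z (i : 'I_n) (c : K) f : subst1 i (c *: f) = c *: subst1 i f.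
Proof. exact: linearZ. Qed.

Lemma subst1_sum (i : 'I_n) (T : finType) (F : T -> P1) :
  subst1 i (\sum_t F t) = \sum_t subst1 i (F t).
Proof. exact: linear_sum. Qed.

Lemma mpolyX1E (m : multinom 1) : mX m = x0 ^+ m ord0.
Proof. by rewrite mpolyXE_id big_ord1. Qed.

(** Extends the defining property of a pure tensor from monomials to products of polynomials in one
    variable each, by multilinear expansion. It makes pure tensors multiply factorwise. *)
Lemma diffop_pure (a : 'I_n -> diffOp K 1) (d : D) (f : 'I_n -> P1) :
  is_pure_tensor a d ->
  d (\prod_i subst1 i (f i)) = \prod_i subst1 i (a i (f i)).
Proof.
(* A common degree bound lets all the [f i] be expanded over one finite index type. *)
move=> ad; pose N := (\max_i msize (f i))%N.
pose c i (b : bmultinom 1 N) := mcoeff (bmnm b) (f i).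
have fE i : f i = \sum_b c i b *: x0 ^+ (bmnm b ord0).
  under eq_bigr => b _ do rewrite -mpolyX1E.
  by apply: mpolywE; rewrite /N (bigD1 i) //= leq_maxl.
have LE : \prod_i subst1 i (f i) = \sum_(phi : {ffun 'I_n -> bmultinom 1 N})
    (\prod_i c i (phi i)) *: mX (Multinom [tuple (bmnm (phi i) ord0 : nat) | i < n]).
  transitivity (\prod_i \sum_b c i b *: mX (e1 i) ^+ (bmnm b ord0)).
    apply: eq_bigr => i _; rewrite {1}(fE i) subst1_sum.
    by apply: eq_bigr => b _; rewrite subst1Z subst1_x0.
  rewrite bigA_distr_bigA; apply: eq_bigr => phi _.
  rewrite scaler_prod mpolyXE_id; congr (_ *: _).
  by apply: eq_bigr => i _; rewrite mnmE.
rewrite LE diffop_sum.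
rewrite (eq_bigr _ (fun phi _ => diffopZ d _ _)).
transitivity (\prod_i \sum_b c i b *: subst1 i (a i (x0 ^+ (bmnm b ord0)))).
  rewrite bigA_distr_bigA; apply: eq_bigr => phi _.
  rewrite ad scaler_prod; congr (_ *: _).
  by apply: eq_bigr => i _; rewrite mnmE.
apply: eq_bigr => i _; rewrite [in RHS](fE i) diffop_sum subst1_sum.
by apply: eq_bigr => b _; rewrite diffopZ subst1Z.
Qed.

Lemma pure_tensorM a b (d e : D) : is_pure_tensor a d -> is_pure_tensor b e ->
  is_pure_tensor (fun i => a i * b i) (d * e).
Proof. by move=> ad be m; rewrite diffopME be (diffop_pure _ ad). Qed.

Lemma pure_tensor1 : is_pure_tensor (fun=> 1) (1 : D).
Proof.
move=> m /=; rewrite mpolyXE_id; apply: eq_bigr => i _.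
by rewrite subst1_x0.
Qed.

Lemma tensor_subalgebra (B : 'I_n -> set (diffOp K 1)) :
  (forall i, subalgebra (B i)) -> subalgebra (tensor B).
Proof.
move=> subB; have sub_t := subspace_lin_span
  [set d : D | exists a, (forall i, B i (a i)) /\ is_pure_tensor a d].
split=> // [|u v].
  apply: sub_lin_span; exists (fun=> 1); split=> [i|]; first by case: (subB i).
  exact: pure_tensor1.
move=> tu; move: v; apply: lin_span_min.
  split=> [|c v w tv tw]; first by rewrite mulr0; case: sub_t.
  by rewrite mulrDr -scalerAr; case: sub_t => _; apply.
move=> v [b [Bb bv]]; move: u tu; apply: lin_span_min.
  split=> [|c u w tu tw]; first by rewrite mul0r; case: sub_t.
  by rewrite mulrDl -scalerAl; case: sub_t => _; apply.
move=> u [a [Ba au]]; apply: sub_lin_span; exists (fun i => a i * b i).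
by split; [move=> i; case: (subB i) => _ _; apply|apply: pure_tensorM].
Qed.

Lemma polyD1_subalgebra : subalgebra (@polyD1 K).
Proof.
split.
- by exists 1 => //; apply: diffop_inj => q /=; rewrite mul1r.
- split=> [|c _ _ [f _ <-] [g _ <-]].
    by exists 0 => //; apply: diffop_inj => q /=; rewrite mul0r.
  by exists (c *: f + g) => //; apply: diffop_inj => q /=; rewrite mulrDl -scalerAl.
by move=> _ _ [f _ <-] [g _ <-]; exists (f * g) => //; rewrite mulopM.
Qed.

Lemma LambdaD1_subalgebra q : subalgebra (@LambdaD1 K q).
Proof.
have sub := subspace_lin_span
  (range (fun j : nat => divop K (mnm_muln (mnm1 (@ord0 0)) (j * q)))).
split=> // [|u v Lu].
  by apply: sub_lin_span; exists 0%N => //; rewrite mul0n [LHS]dop0.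
move: v; apply: lin_span_min.
  split=> [|c v w tv tw]; first by rewrite mulr0; case: sub.
  by rewrite mulrDr -scalerAr; case: sub => _; apply.
move=> _ [j _ <-]; move: u Lu; apply: lin_span_min.
  split=> [|c u w tu tw]; first by rewrite mul0r; case: sub.
  by rewrite mulrDl -scalerAl; case: sub => _; apply.
move=> _ [l _ <-]; have := @dopM K 1 ord0 (l * q) (j * q); rewrite /dop => ->.
rewrite -scaler_nat; apply: subspaceZ => //; apply: sub_lin_span.
by exists (l + j)%N => //; rewrite mulnDl.
Qed.

Lemma pure_tensor_at (y : D) (a : diffOp K 1) (i : 'I_n) :
  (forall m, y (mX m) =
     subst1 i (a (x0 ^+ m i)) * \prod_(k | k != i) mX (e1 k) ^+ m k) ->
  is_pure_tensor (fun k => if k == i then a else 1) y.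
Proof.
move=> ya m; rewrite ya [RHS](bigD1 i) //= eqxx; congr (_ * _).
by apply: eq_bigr => k /negPf->; rewrite subst1_x0.
Qed.

Lemma pure_tensor_xop (i : 'I_n) (j : nat) :
  is_pure_tensor (fun k => if k == i then mulop (x0 ^+ j) else 1) (xop K i ^+ j).
Proof.
apply: pure_tensor_at => m /=; rewrite -exprD subst1_x0.
have -> : xop K i ^+ j = mulop (mX (e1 i) ^+ j).
  elim: j => [|j IH]; first by apply: diffop_inj => q /=; rewrite mul1r.
  by rewrite !exprS IH mulopM.
by rewrite /= exprD -mulrA; congr (_ * _); rewrite mpolyXE_id (bigD1 i).
Qed.

Lemma pure_tensor_dop (i : 'I_n) (j : nat) :
  is_pure_tensor (fun k => if k == i then divop K (mnm_muln (mnm1 ord0) j) else 1)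
    (dop K i j).
Proof.
apply: pure_tensor_at => m; rewrite divopX.
rewrite (_ : x0 ^+ m i = mX (mnm_muln (mnm1 ord0) (m i))); last first.
  by rewrite [RHS]mpolyX1E mulmnE mnm1E eqxx mul1n.
rewrite divopX subst1Z mpolyX1E subst1_x0 big_ord1 -scalerAl; congr (_%:R *: _).
  rewrite (bigD1 i) //= big1 ?muln1 => [|k /negPf ki].
    by rewrite !mulmnE !mnm1E !eqxx !mul1n.
  by rewrite !mulmnE !mnm1E eq_sym ki !mul0n bin0.
rewrite mpolyXE_id (bigD1 i) //= !mnmBE !mulmnE !mnm1E !eqxx !mul1n; congr (_ * _).
apply: eq_bigr => k /negPf ki.
by rewrite !mnmBE !mulmnE !mnm1E eq_sym ki !mul0n subn0.
Qed.

End Tensor.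

(** * Independent families inside Lambda_epsilon, controlled by the filtration *)

Section FreeFamily.
Variables (K : fieldType) (n : nat).
Local Notation D := (diffOp K n).

Definition LambdaE (e : 'I_n -> bool) : set D :=
  tensor (fun i => if e i then @polyD1 K else @LambdaD1 K 1).

Lemma LambdaE_subalgebra e : subalgebra (LambdaE e).
Proof.
apply: tensor_subalgebra => i; case: ifP => _; first exact: polyD1_subalgebra.
exact: LambdaD1_subalgebra.
Qed.

Local Notation lambdaX := (lambda_gen (@xop K n) (@dop K n)).

Fixpoint lambda_monomial (e : 'I_n -> bool) (s : seq 'I_n) (al : seq nat) : D :=
  match s, al with
  | i :: s', j :: al' => lambdaX e i j * lambda_monomial e s' al'
  | _, _ => 1
  end.

Lemma LambdaE_gen e i j : LambdaE e (lambdaX e i j).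
Proof.
rewrite /lambda_gen; case: (boolP (e i)) => ei; apply: sub_lin_span.
  eexists; split; last exact: pure_tensor_xop.
  move=> k /=; have [->|_] := eqVneq k i.
    by rewrite ei; exists (mpolyX K (mnm1 ord0) ^+ j).
  by case: ifP => _; [case: (@polyD1_subalgebra K)|case: (@LambdaD1_subalgebra K 1)].
eexists; split; last exact: pure_tensor_dop.
move=> k /=; have [->|_] := eqVneq k i.
  by rewrite (negPf ei); apply: sub_lin_span; exists j => //; rewrite muln1.
by case: ifP => _; [case: (@polyD1_subalgebra K)|case: (@LambdaD1_subalgebra K 1)].
Qed.

Lemma LambdaE_monomial e s al : LambdaE e (lambda_monomial e s al).
Proof.
have [L1 _ LM] := LambdaE_subalgebra e.
elim: s al => [|i s IH] [|j al] //=.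
by apply: LM => //; apply: LambdaE_gen.
Qed.

Lemma canF_lambda_gen e i j l d : canF l d -> canF (j + l) (lambdaX e i j * d).
Proof.
rewrite /lambda_gen; case: ifP => _; last exact: dop_canF.
move=> Fd; elim: j => [|j IH]; first by rewrite mul1r.
by rewrite exprS -mulrA addSn; apply: xop_canF.
Qed.

Lemma canF_monomial e s al l d :
  canF l d -> canF (sumn al + l) (lambda_monomial e s al * d).
Proof.
move=> Fd; elim: s al => [|i s IH] [|j al] /=; rewrite ?mul1r //.
  by apply: canF_sub Fd; apply: leq_addl.
by rewrite -mulrA -addnA; apply: canF_lambda_gen.
Qed.

Variable M : lmodType D.

Lemma resKE (c : K) (v : M) : (c *: (v : resK M) : resK M) = (c%:A : D) *: v.
Proof. by []. Qed.

Lemma resK_act (a : D) (c : K) (v : M) :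
  a *: (c *: (v : resK M) : M) = (c *: (a *: v : resK M) : resK M).
Proof. by rewrite !resKE !scalerA mulr_algr mulr_algl. Qed.

Lemma resK_scaleA (a : D) (c : K) (v : M) :
  (c *: a) *: v = (c *: (a *: v : resK M) : resK M).
Proof. by rewrite resKE scalerA mulr_algl. Qed.

(** A single sum over exponent tuples, from which a linearly independent family can be read off; the
    reindexing splits a tuple into head and tail. *)
Lemma nested_sum_flat A (rho : A -> D) e s B v c :
  nested_sum (@xop K n) (@dop K n) rho e s B v c =
  \sum_(t : (size s).-tuple 'I_B)
    lambda_monomial e s (map (@nat_of_ord B) t) *:
      (rho (c (map (@nat_of_ord B) t)) *: v) :> M.
Proof.
elim: s c => [|i s IH] c /=.
  rewrite (big_pred1 [tuple]) /= ?scale1r // => t.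
  by rewrite [t]tuple0 /= eqxx.
rewrite (reindex (fun q : 'I_B * (size s).-tuple 'I_B => [tuple of q.1 :: q.2])).
  rewrite -(pair_bigA _ (fun (j : 'I_B) (t : (size s).-tuple 'I_B) =>
     (lambdaX e i j * lambda_monomial e s (map (@nat_of_ord B) t)) *:
        (rho (c (nat_of_ord j :: map (@nat_of_ord B) t)) *: v))) /=.
  apply: eq_bigr => j _; rewrite IH scaler_sumr; apply: eq_bigr => t _.
  by rewrite !scalerA mulrA.
exists (fun t : (size s).+1.-tuple 'I_B => (thead t, [tuple of behead t])).
  by move=> [j t] _ /=; congr pair; apply: val_inj.
by move=> t _; rewrite /= -tuple_eta.
Qed.

(** [free_vector] with [A] = K and [N] = M, restricted to monomials of total degree at most [k]. The
    same [e] and [v] serve all [k]. *)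
Lemma free_family (p : nat) : p \in [pchar K] -> (exists v : M, v != 0) ->
  exists e (v : M), v != 0 /\ forall k, exists b : 'I_('C(n + k, n)) -> D,
    [/\ forall r, LambdaE e (b r),
        forall r l d, canF l d -> canF (k + l) (b r * d) &
        lin_indep (fun r => b r *: v : resK M)].
Proof.
move=> charK [u u0]; pose s := enum 'I_n.
have [e [v [_ free]]] : exists e (v : M), True /\ forall B c,
    nested_sum (@xop K n) (@dop K n) (in_alg D) e s B v c = 0 ->
    forall al, size al = size s -> all (gtn B) al -> c al = 0.
  apply: (@free_vector _ _ _ _ _ (@dop0 K n) (@dopM K n) (@xop_dop K n)
    (@xop_comm K n) (@xop_dopC K n) _ p s _ (in_alg D) (fun=> True)) => //.
  - by move=> *; apply: dop_comm.
  - exact: enum_uniq.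
  - by move=> i a _; rewrite /GRing.comm mulr_algr mulr_algl.
  - by move=> i j a _; rewrite /GRing.comm mulr_algr mulr_algl.
  - move=> c w _ /= cw; have [->|c0] := eqVneq c 0; [by left|right].
    have := congr1 (fun w => (c^-1%:A : D) *: w) cw.
    by rewrite scaler0 scalerA -scalerAl mul1r scalerA mulVf // scale1r scale1r.
  - by exists u.
exists e, v; split.
  (* Were [v] zero, the coefficient 1 on the monomial 1 would give a nontrivial relation. *)
  apply/eqP => v0; have := @free 1%N (fun=> 1) _ (nseq (size s) 0%N).
  rewrite nested_sum_flat big1 => [|t _]; last by rewrite v0 !scaler0.
  rewrite size_nseq all_nseq orbT => /(_ erefl erefl erefl) /eqP.
  by rewrite oner_eq0.
move=> k; pose T := [set t : (size s).-tuple 'I_k.+1 | (\sum_(i <- t) i <= k)%N]%SET.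
have cardT : #|T| = 'C(n + k, n) by rewrite card_partial_ord_partitions size_enum_ord.
rewrite -cardT; pose al (r : 'I_#|T|) := map (@nat_of_ord k.+1) (enum_val r).
have al_inj r r' : al r = al r' -> r = r'.
  by move=> /(inj_map (@ord_inj _)) /val_inj /enum_val_inj.
exists (fun r => lambda_monomial e s (al r)); split.
- by move=> r; apply: LambdaE_monomial.
- move=> r l d Fd; apply: canF_sub (canF_monomial e s (al r) Fd).
  rewrite leq_add2r /al sumnE big_map.
  by have := enum_valP r; rewrite inE.
move=> c E r.
(* Extends the coefficients by zero to all exponent lists. *)
pose c' a := \sum_r c r * (a == al r)%:R.
have := free k.+1 c' _ (al r); rewrite /al size_map size_tuple.
have cE : c' (al r) = c r.
  rewrite /c' (bigD1 r) //= eqxx mulr1 big1 ?addr0 // => r' ne.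
  case: eqP => [/al_inj E'|_]; last by rewrite mulr0.
  by rewrite E' eqxx in ne.
rewrite -[map _ _]/(al r) cE; apply=> //; last first.
  by apply/allP => _ /mapP[j _ ->] /=.
rewrite nested_sum_flat -[RHS]E.
transitivity (\sum_(t : (size s).-tuple 'I_k.+1) \sum_r
   (if t == enum_val r then c r *: (lambda_monomial e s (al r) *: v : resK M)
    else 0 : resK M)).
  apply: eq_bigr => t _.
  rewrite /c' -[in_alg _ _ *: v]/((_ : K) *: (v : resK M)) scaler_suml.
  rewrite scaler_sumr; apply: eq_bigr => r' _.
  rewrite (inj_eq (inj_map (@ord_inj _))) val_eqE; case: eqP => [->|_].
    by rewrite mulr1 resK_act.
  by rewrite mulr0 scale0r scaler0.
rewrite exchange_big; apply: eq_bigr => r' _.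
by rewrite (bigD1 (enum_val r')) //= eqxx big1 ?addr0 // => t /negPf->.
Qed.

End FreeFamily.

(** * Growth and holonomic sets *)

Section ActSpan.
Variables (K : fieldType) (n : nat) (M : lmodType (diffOp K n)).
Local Notation D := (diffOp K n).
Implicit Types (A : set D) (W : set (resK M)).

Lemma act_spanP A W a (w : M) : A a -> W w -> act_span A W (a *: w).
Proof. by move=> Aa Ww; apply: sub_lin_span; exists a => //; exists w. Qed.

Lemma act_span_min A W (S : set (resK M)) : is_subspace S ->
  (forall a (w : M), A a -> W w -> S (a *: w)) -> act_span A W `<=` S.
Proof.
move=> sS H; rewrite /act_span; apply: (lin_span_min sS) => _ [a Aa [w Ww <-]].
exact: H.
Qed.

Lemma subspace_act_span A W : is_subspace (act_span A W).
Proof. exact: subspace_lin_span. Qed.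

Lemma act_spanS A A' W : A `<=` A' -> act_span A W `<=` act_span A' W.
Proof.
move=> AA'; apply: act_span_min; first exact: subspace_act_span.
by move=> a w /AA' A'a Ww; apply: act_spanP.
Qed.

(** With [subspace_preim_op], this lets inclusions of [act_span] be checked on generators, first in
    the vector and then in the operator. *)
Lemma subspace_preim (a : D) (S : set (resK M)) : is_subspace S ->
  is_subspace [set w : resK M | S (a *: (w : M))].
Proof.
move=> sS; split=> [|c u v Su Sv] /=; first by rewrite scaler0; case: sS.
by rewrite scalerDr resK_act; case: sS => _; apply.
Qed.

Lemma subspace_preim_op (w : M) (S : set (resK M)) : is_subspace S ->
  is_subspace [set a : D | S (a *: w)].
Proof.
move=> sS; split=> [|c u v Su Sv] /=; first by rewrite scale0r; case: sS.
by rewrite scalerDl resK_scaleA; case: sS => _; apply.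
Qed.

Lemma act_span_canF_fin l W : fin_dim W ->
  exists (T : finType) (g : T -> resK M),
    act_span (@canF K n l) W `<=` lin_span (range g).
Proof.
move=> [r [b [_ ->]]].
exists ((bmultinom n l.+1 * bmultinom n l.+1) * 'I_r)%type.
exists (fun t => weyl_monomial K (bmnm t.1.1) (bmnm t.1.2) *: (b t.2 : M)).
apply: act_span_min => [|a w]; first exact: subspace_lin_span.
move=> Fa; move: w; apply: (lin_span_min (subspace_preim a (@subspace_lin_span _ _ _))).
move=> _ [i _ <-]; move: a Fa.
apply: (lin_span_min (subspace_preim_op _ (@subspace_lin_span _ _ _))).
move=> _ [al [be [le ->]]]; apply: sub_lin_span.
have lt_al : (mdeg al < l.+1)%N by rewrite ltnS (leq_trans _ le) ?leq_addr.
have lt_be : (mdeg be < l.+1)%N by rewrite ltnS (leq_trans _ le) ?leq_addl.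
by exists ((BMultinom lt_al, BMultinom lt_be), i).
Qed.

Lemma lin_indep_act_span A l W s (b : 'I_s -> resK M) : fin_dim W ->
  A `<=` @canF K n l -> lin_indep b -> (forall i, act_span A W (b i)) ->
  (s <= dimK (act_span A W))%N.
Proof.
move=> fW AF; have [T [g sg]] := act_span_canF_fin l fW.
apply: (lin_indep_dimK (g := g)); first exact: subspace_act_span.
exact: subset_trans (act_spanS AF) sg.
Qed.

Lemma act_span_exhaust W v : act_span setT W v -> exists l, act_span (@canF K n l) W v.
Proof.
move: v; apply: act_span_min.
  split=> [|c u v [l Fu] [l' Fv]].
    by exists 0%N; case: (subspace_act_span (@canF K n 0) W).
  exists (maxn l l'); case: (subspace_act_span (@canF K n (maxn l l')) W) => _; apply.
    by apply: act_spanS Fu; apply/canF_sub/leq_maxl.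
  by apply: act_spanS Fv; apply/canF_sub/leq_maxr.
move=> a w _ Ww; have [l Fa] := canF_exhaust a; exists l.
exact: act_spanP.
Qed.

Lemma act_span_mul (b : D) k l W v :
  (forall d, canF l d -> canF (k + l) (b * d)) ->
  act_span (@canF K n l) W v -> act_span (@canF K n (k + l)) W (b *: (v : M)).
Proof.
move=> H; move: v; have := subspace_preim b (subspace_act_span (@canF K n (k + l)) W).
move/act_span_min; apply.
by move=> a w Fa Ww /=; rewrite scalerA; apply: act_spanP => //; apply: H.
Qed.

End ActSpan.

(** * The module P_n, of dimension at most n *)

Section PolynomialModule.
Variables (K : fieldType) (n : nat).
Local Notation D := (diffOp K n).

(** A copy of P_n carrying the action of D(P_n) in place of the scaling by K. *)
Definition polyMod : Type := mpoly n K.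

HB.instance Definition _ := GRing.Zmodule.on polyMod.

Definition polyMod_scale (d : D) (q : polyMod) : polyMod := d q.

Fact polyMod_scaleA a b q :
  polyMod_scale a (polyMod_scale b q) = polyMod_scale (a * b) q.
Proof. by []. Qed.
Fact polyMod_scale1 : left_id 1 polyMod_scale.
Proof. by []. Qed.
Fact polyMod_scaleDr : right_distributive polyMod_scale +%R.
Proof. by move=> a q r; apply: diffopD. Qed.
Fact polyMod_scaleDl q : {morph polyMod_scale^~ q : a b / a + b}.
Proof. by []. Qed.

HB.instance Definition _ := GRing.Zmodule_isLmodule.Build D polyMod
  polyMod_scaleA polyMod_scale1 polyMod_scaleDr polyMod_scaleDl.

Definition poly_one : polyMod := (1 : mpoly n K).

Lemma poly_one_neq0 : poly_one != 0.
Proof. exact: oner_neq0. Qed.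

Lemma polyMod_gen : act_span setT (lin_span [set (poly_one : resK polyMod)]) = setT.
Proof.
apply/seteqP; split=> // q _.
have -> : q = mulop (q : mpoly n K) *: poly_one.
  by rewrite /GRing.scale /= /polyMod_scale /= mulr1.
by apply: act_spanP => //; apply: sub_lin_span.
Qed.

(** Applied to 1, x^al d^[be] vanishes unless be = 0, so the monomials with exponents in a cube of
    side l + 1 span; this crude count has the right growth. *)
Lemma polyMod_dim l :
  (dimK (act_span (@canF K n l) (lin_span [set (poly_one : resK polyMod)])) <=
   l.+1 ^ n)%N.
Proof.
rewrite -[l.+1]card_ord -[X in (_ ^ X)%N]card_ord -card_ffun.
apply: (@dimK_leq _ _ _ (fun phi : {ffun 'I_n -> 'I_l.+1} =>
  (mpolyX K (Multinom [tuple (phi i : nat) | i < n]) : resK polyMod))).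
  exact: subspace_act_span.
apply: act_span_min => [|a w Fa]; first exact: subspace_lin_span.
move: w; apply: (lin_span_min (subspace_preim a (@subspace_lin_span _ _ _))).
move=> _ ->; move: a Fa.
apply: (lin_span_min (subspace_preim_op _ (@subspace_lin_span _ _ _))).
move=> _ [al [be [le ->]]] /=.
have -> : (mulop (mpolyX K al) * divop K be) *: poly_one =
    (((be == mnm0)%:R : K) *: (mpolyX K al : resK polyMod) : resK polyMod).
  transitivity (mpolyX K al * divop K be (mpolyX K mnm0)).
    by rewrite mpolyX0.
  rewrite divop_top ?mdeg0 //; case: eqP => _.
    by rewrite mulr1 scale1r.
  by rewrite mulr0 scale0r.
apply: subspaceZ; first exact: subspace_lin_span.
apply: sub_lin_span; exists [ffun i => inord (al i)] => //.
congr mpolyX; apply/mnmP => i; rewrite mnmE ffunE inordK // ltnS.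
apply: leq_trans (leq_trans (leq_addr _ _) le).
by rewrite mdegE (bigD1 i) //= leq_addr.
Qed.

End PolynomialModule.

(** * Growth of dimension functions *)

Section Growth.
Variable R : realType.

Lemma powR_large (s C : R) : 0 < s -> \forall i \near \oo, C <= (i%:R : R) `^ s.
Proof.
move=> s0; pose C' := Num.max C 0.
have C'0 : 0 <= C' by rewrite le_max lexx orbT.
exists (Num.truncn (C' `^ s^-1)).+1 => // i /= lei.
apply: (@le_trans _ _ C'); first by rewrite le_max lexx.
have -> : C' = (C' `^ s^-1) `^ s by rewrite -powRrM mulVf ?gt_eqF // powRr1.
apply: ge0_ler_powR; rewrite ?nnegrE ?powR_ge0 ?ler0n //; first exact: ltW.
apply/ltW/(lt_le_trans (truncnS_gt _)); by rewrite ler_nat.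
Qed.

(** Each of the n factors on the right is at least k; this yields 'C(n + k, n) >= k^n / n!. *)
Lemma leq_exp_ffact (n k : nat) : (k ^ n <= (n + k) ^_ n)%N.
Proof.
elim: n => [|n IH]; first by rewrite ffactn0.
by rewrite expnS addSn ffactSS leq_mul // leqW // leq_addl.
Qed.

(** For each e > 0, eventually (i + 1)^n <= 2^n i^n <= i^(n + e). *)
Lemma growth_le (f : nat -> nat) (n : nat) :
  (forall i, (f i <= i.+1 ^ n)%N) -> (growth R f <= (n%:R : R)%:E)%E.
Proof.
move=> fle; apply/lee_addgt0Pr => e e0; apply: ereal_inf_lbound.
exists (n%:R + e); last by rewrite EFinD.
split; first by rewrite addr_ge0 ?ler0n // ltW.
have [N _ large] := powR_large (2 ^+ n) (e0 : 0 < (e : R)).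
exists (maxn N 1) => // i /=; rewrite geq_max => /andP[leNi i_gt0].
apply: (@le_trans _ _ ((i.+1 ^ n)%N%:R)); first by rewrite ler_nat.
rewrite powRD; last by rewrite pnatr_eq0 -lt0n i_gt0 implybT.
rewrite powR_mulrn ?ler0n //.
apply: (@le_trans _ _ ((2 * i) ^ n)%N%:R).
  by rewrite ler_nat; case: (posnP n) => [->//|n_gt0]; rewrite leq_exp2r //; lia.
rewrite expnMn natrM natrX natrX mulrC ler_wpM2l ?exprn_ge0 ?ler0n //.
exact: large.
Qed.

(** An exponent r < n would give k^n <= n! f(k + l) <= n! 2^r k^r for large k >= l, so k^(n-r) would
    stay bounded. *)
Lemma growth_ge (f : nat -> nat) (n l : nat) :
  (forall k, ('C(n + k, n) <= f (k + l))%N) -> ((n%:R : R)%:E <= growth R f)%E.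
Proof.
move=> fge; apply: le_ereal_inf_tmp => _ [r [r0 fr] <-]; rewrite lee_fin leNgt.
apply/negP => rn.
pose s : R := n%:R - r; have s0 : 0 < s by rewrite subr_gt0.
(* The added 1 makes the final contradiction strict. *)
have [N1 _ large] := powR_large (2%:R `^ r * n`!%:R + 1) s0.
have [N2 _ fr'] := fr.
have [k [leN1k leN2k le_lk k_gt0]] :
    exists k, [/\ N1 <= k, N2 <= k, l <= k & 0 < k]%N.
  by exists (maxn N1 (maxn N2 l)).+1; split; lia.
have kr : 0 < (k%:R : R) `^ r by apply: powR_gt0; rewrite ltr0n.
have ks := large k leN1k.
have fk := fr' (k + l)%N (leq_trans leN2k (leq_addr _ _)).
have : (k ^ n)%:R <= n`!%:R * (2%:R `^ r * k%:R `^ r) :> R.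
  apply: (@le_trans _ _ (n`!%:R * (f (k + l))%:R)).
    rewrite -natrM ler_nat (leq_trans (leq_exp_ffact n k)) // -bin_ffact mulnC.
    by rewrite leq_pmul2l ?fact_gt0.
  rewrite ler_wpM2l ?ler0n // (le_trans fk) // -powRM ?ler0n // -natrM.
  by rewrite ge0_ler_powR ?nnegrE ?ler0n // ler_nat; lia.
rewrite natrX -powR_mulrn ?ler0n // (_ : n%:R = s + r); last by rewrite subrK.
rewrite powRD; last by rewrite pnatr_eq0 -lt0n k_gt0 implybT.
rewrite mulrA ler_pM2r // leNgt => /negP; apply.
by apply: lt_le_trans ks; rewrite mulrC ltrDl.
Qed.

End Growth.

(** * The holonomic number and the criterion for holonomic sets *)

Section Holonomic.
Variables (R : realType) (K : fieldType) (p n : nat).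
Hypothesis charK : p \in [pchar K].
Local Notation D := (diffOp K n).

Lemma growth_act_span_ge (M : lmodType D) (M0 : set (resK M)) :
  (exists v : M, v != 0) -> fin_dim M0 -> act_span setT M0 = setT ->
  ((n%:R : R)%:E <= growth R (fun i => dimK (act_span (@canF K n i) M0)))%E.
Proof.
move=> nzM fM0 genM; have [e [v [v0 fam]]] := free_family charK nzM.
have [l Flv] : exists l, act_span (@canF K n l) M0 v.
  by apply: act_span_exhaust; rewrite genM.
apply: (@growth_ge _ _ _ l) => k; have [b [_ bF indb]] := fam k.
apply: lin_indep_act_span fM0 (@subset_refl _ _) indb _ => r.
by apply: act_span_mul Flv => d; apply: bF.
Qed.

Lemma holonomic_number_eq : holonomic_number R K n = (n%:R)%:E.
Proof.
apply/eqP; rewrite eq_le; apply/andP; split.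
  have M0fin : fin_dim (lin_span [set (poly_one K n : resK (polyMod K n))]).
    by exists 1%N; apply/has_dim1/poly_one_neq0.
  apply: (@le_trans _ _ (growth R (fun i => dimK (act_span (@canF K n i)
    (lin_span [set (poly_one K n : resK (polyMod K n))]))))).
    apply: ereal_inf_lbound; exists (polyMod K n); split.
      by exists (poly_one K n); apply: poly_one_neq0.
    exists (lin_span [set (poly_one K n : resK (polyMod K n))]).
    by split=> //; apply: polyMod_gen.
  by apply: growth_le => i; apply: polyMod_dim.
apply: le_ereal_inf_tmp => _ [M [nzM [M0 [fM0 genM ->]]]].
exact: growth_act_span_ge.
Qed.

(** It suffices that the family contains every Lambda_epsilon: V = K v works, with error term 0,
    because the binomial bound holds for every i. *)
Lemma holonomic_set_LambdaE (Cs : set (set D)) :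
  (forall C, Cs C -> subalgebra C) -> (forall e, Cs (LambdaE e)) ->
  holonomic_set Cs (1 : R).
Proof.
move=> subCs CsL; split=> //; first by move=> C /subCs; apply: subalgebra_closed.
  exact: holonomic_number_eq.
move=> M nzM; have [e [v [v0 fam]]] := free_family charK nzM.
have fV : fin_dim (lin_span [set (v : resK M)]) by exists 1%N; apply: has_dim1.
exists (lin_span [set (v : resK M)]), (LambdaE e); split=> //.
  by exists v => //; apply: sub_lin_span.
exists (fun=> 0); split.
  by apply/eqoP => eps eps0; apply: nearW => i; rewrite normr0 mulr_ge0 // ltW.
move=> i; rewrite addr0; apply: (@le_trans _ _ ('C(n + i, n)%:R)).
  rewrite mulrC div1r ler_pdivrMr ?ltr0n ?fact_gt0 // -natrM bin_ffact -natrX.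
  by rewrite ler_nat leq_exp_ffact.
have [b [bL bF indb]] := fam i; rewrite ler_nat.
apply: lin_indep_act_span fV _ indb _ => [|r]; first exact: subIsetr.
apply: act_spanP; last exact: sub_lin_span.
split; first exact: bL.
(* Multiplying 1, which lies in F_0, shows that [b r] itself lies in F_i. *)
have := bF r 0%N 1; rewrite addn0 mulr1; apply.
rewrite -(divop0 K n) -[divop _ _]mul1r (_ : 1 = mulop (mpolyX K mnm0)); last first.
  by apply: diffop_inj => q /=; rewrite mpolyX0 mul1r.
by apply: canF_mono; rewrite !mdeg0.
Qed.

End Holonomic.

(** * Both families consist of subalgebras and contain every Lambda_epsilon *)

Section Families.
Variables (K : fieldType) (p n : nat).

Lemma calC_subalgebra C : calC K p n C -> subalgebra C.
Proof.
move=> [s [k [t [_ ->]]]]; apply: tensor_subalgebra => i; case: ifP => _.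
  exact: polyD1_subalgebra.
exact: LambdaD1_subalgebra.
Qed.

Lemma calC'_subalgebra C : calC' K n C -> subalgebra C.
Proof.
move=> [e [_ ->]]; apply: tensor_subalgebra => i; case: ifP => _.
  exact: polyD1_subalgebra.
exact: LambdaD1_subalgebra.
Qed.

Lemma calC'_LambdaE e : calC' K n (@LambdaE K n e).
Proof.
exists (fun i => if e i then 1 else -1); split=> [i|].
  by case: (e i); [left|right].
by rewrite /LambdaE; congr tensor; apply/funext => i; case: (e i).
Qed.

(** Lists [A] before its complement and sends each index to its position; any set of variables can
    thus be the polynomial part of a member of [calC]. *)
Lemma perm_initial (A : {set 'I_n}) :
  exists t : 'S_n, forall i, (t i < #|A|)%N = (i \in A).
Proof.
pose l := enum A ++ enum (~: A).
have mem_l i : i \in l by rewrite mem_cat !mem_enum inE orbN.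
have size_l : size l = n.
  by rewrite size_cat -!cardE cardsC card_ord.
have lt_l i : (index i l < n)%N by rewrite -[X in (_ < X)%N]size_l index_mem.
have inj_l : injective (fun i => Ordinal (lt_l i)).
  by move=> i j /(congr1 (@nat_of_ord n)) /= /(congr1 (nth i l)); rewrite !nth_index.
exists (perm inj_l) => i; rewrite permE /= index_cat mem_enum cardE.
case: ifP => iA; first by rewrite index_mem mem_enum.
by apply/negbTE; rewrite -leqNgt leq_addr.
Qed.

Lemma calC_LambdaE e : calC K p n (@LambdaE K n e).
Proof.
have [t tE] := perm_initial [set i | e i]%SET.
(* All k_i are 0, so that p^(k_i) = 1 gives the full algebra of divided powers. *)
exists #|[set i | e i]%SET|, (fun=> 0%N), t; split.
  by rewrite -[X in (_ <= X)%N]card_ord max_card.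
by rewrite /LambdaE; congr tensor; apply/funext => i; rewrite tE inE expn0.
Qed.

End Families.

Theorem theorem9p5 (R : realType) (K : fieldType) (p : nat)
    (charK : p \in [pchar K]%R) (n : nat) (n_gt0 : (0 < n)%N) :
  holonomic_set (calC K p n) (1%R : R) /\ holonomic_set (calC' K n) (1%R : R).
Proof.
split; apply: (holonomic_set_LambdaE _ charK).
- exact: calC_subalgebra.
- exact: calC_LambdaE.
- exact: calC'_subalgebra.
- exact: calC'_LambdaE.
Qed.
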